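(* Let $f:X\to X$ be an acyclic countable-to-one Borel function on a standard probability space $(X,\mu)$ such that $E_f$ is mcp and $\mu$-nowhere smooth, with Radon--Nikodym cocycle $\rho$. Then (a) $f$ is $\rho$-monobarytropic if and only if, after discarding an $E_f$-invariant Borel null set, $f$ is essentially one-ended. (b) $f$ is $\rho$-dibarytropic if and only if, after discarding an $E_f$-invariant Borel null set, $f$ is essentially two-ended. (c) $f$ is $\rho$-polybarytropic if and only if $f$ is $\mu$-nowhere essentially finitely-ended.
   Context: Functions. $f$ is acyclic if $f^n(x)\ne x$ for all $n\ge1$, $x\in X$. $T_f$ is the (acyclic) graph $\{(x,y):f(x)=y\text{ or }f(y)=x\}$, and $E_f$ is its connectedness equivalence relation. Cocycle. A countable Borel equivalence relation $E$ is mcp on $(X,\mu)$ if the $E$-saturation of every null set is null. Its Radon--Nikodym cocycle is the (unique up to null sets) Borel $\rho:E\to(0,\infty)$ with $\rho(z,y)\rho(y,x)=\rho(z,x)$ and, writing $\rho^x(y):=\rho(y,x)$, $\int_X\sum_{y\in[x]_E}h(x,y)\,d\mu(x)=\int_X\sum_{y\in[x]_E}h(y,x)\rho^x(y)\,d\mu(x)$ for all Borel $h:E\to[0,\infty]$. A set $D\subseteq[x]_E$ is $\rho$-finite or $\rho$-infinite according to whether $\sum_{y\in D}\rho^x(y)$ is finite or infinite (independent of $x$ in the class). $E$ is smooth if it has a Borel transversal, and $\mu$-nowhere smooth if there is no $E$-invariant Borel set $A$ of positive measure with $E|_A$ smooth. Ends. A geodesic ray is an injective infinite path in an acyclic graph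 $T$; ends are classes of rays modulo having a common tail. A half-space is a $T$-connected vertex set $U$ with exactly one edge joining $U$ to its complement; its closure is $U$ together with all ends represented by rays in $U$. An end $\xi$ is $\rho$-barytropic if every half-space whose closure contains $\xi$ is $\rho$-infinite. $f$ is $\rho$-monobarytropic (respectively $\rho$-dibarytropic, $\rho$-polybarytropic) if a.e. $T_f$-component has exactly one (respectively exactly two, at least three) $\rho$-barytropic ends. A set $Y$ of vertices is $T$-convex if it contains the geodesic path between any two of its points lying in the same component. $T$ is $\kappa$-ended if each component has exactly $\kappa$ ends, and essentially $\kappa$-ended if there is a $T$-convex Borel set $Y$ meeting every $E_T$-class such that $T|_Y$ is $\kappa$-ended. $f$ is essentially $n$-ended if $T_f$ is. $f$ is $\mu$-nowhere essentially finitely-ended if there is no $E_f$-invariant Borel set $A$ of positive measure and no $n\in\mathbb N=\{0,1,\dots\}$ such that $T_f|_A$ is essentially $n$-ended. *)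

(* Defs.v *)
From mathcomp Require Import all_boot all_order all_algebra.
From mathcomp Require Import all_classical all_reals all_analysis.
From mathcomp Require Import measurable_realfun.

Set Implicit Arguments.
Unset Strict Implicit.
Unset Printing Implicit Defensive.

Import Order.TTheory GRing.Theory Num.Theory.
Local Open Scope classical_set_scope.
Local Open Scope ring_scope.
Local Open Scope card_scope.

(* The sigma-algebra of X is the Borel sigma-algebra of a Polish topology:
   X is in bijection with a separable, complete (Hausdorff) metric space, the
   measurable sets corresponding to the Borel sets. *)
Definition standard_borel (R : realType) d (X : measurableType d) : Prop :=
  exists (P : completePseudoMetricType R) (phi : X -> P),
    [/\ hausdorff_space P, @second_countable P, bijective phi &
        forall A : set X,
          measurable A <-> <<s [set U : set P | open U] >> (phi @` A)].

Section Graph.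
Variable X : choiceType.
Implicit Types (T : rel X) (x y : X) (U V Y : set X) (r s : nat -> X).

Definition joined T x y : Prop := exists2 p, path T x p & y = last x p.

Definition connectedness T : set (X * X) := [set p | joined T p.1 p.2].

Definition induced T Y : rel X := [rel x y | [&& x \in Y, y \in Y & T x y]].

Definition geodesic_ray T r : Prop :=
  injective r /\ forall n, T (r n) (r n.+1).

Definition tail_equiv r s : Prop :=
  exists m n, forall k, r (m + k)%N = s (n + k)%N.

Definition end_of T r : set (nat -> X) :=
  [set s | geodesic_ray T s /\ tail_equiv r s].

(* The ends, as equivalence classes of rays, of the component of x. *)
Definition ends T x : set (set (nat -> X)) :=
  [set xi | exists r, [/\ geodesic_ray T r, joined T x (r 0%N) &
                         xi = end_of T r]].

Definition graph_connected T U : Prop :=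
  forall x y, U x -> U y -> joined (induced T U) x y.

(* An edge joining U to its complement is recorded as the pair formed by its
   endpoint in U and its endpoint outside U. *)
Definition half_space T U : Prop :=
  graph_connected T U /\
  exists! e : X * X, [/\ U e.1, ~ U e.2 & T e.1 e.2].

Definition in_closure U (xi : set (nat -> X)) : Prop :=
  exists2 r, xi r & forall n, U (r n).

(* In an acyclic graph, the duplicate-free paths are the geodesics. *)
Definition graph_convex T Y : Prop :=
  forall x (p : seq X), path T x p -> uniq (x :: p) ->
    Y x -> Y (last x p) -> forall z, z \in p -> Y z.

(* The graph T|_V, with vertex set V, is n-ended. *)
Definition n_ended T V (n : nat) : Prop :=
  forall x, V x -> ends (induced T V) x #= `I_n.

End Graph.

(* The graph T|_V, with vertex set V, is essentially n-ended; for Y included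
   in V, the graphs (T|_V)|_Y and T|_Y are the same. *)
Definition essentially_ended d (X : measurableType d) (T : rel X) (V : set X)
    (n : nat) : Prop :=
  exists Y : set X, [/\ measurable Y, Y `<=` V, graph_convex (induced T V) Y,
    (forall x, V x -> exists2 y, Y y & joined (induced T V) x y) &
    n_ended T Y n].

Section EquivalenceRelation.
Variables (R : realType) (d : measure_display) (X : measurableType d).
Variables (mu : probability X R) (E : set (X * X)).

Definition invariant_set (A : set X) : Prop :=
  forall x y, E (x, y) -> A x -> A y.

Definition saturation (A : set X) : set X :=
  [set y | exists2 x, A x & E (x, y)].

Definition mcp : Prop :=
  forall N : set X, mu.-negligible N -> mu.-negligible (saturation N).

(* rho takes junk values outside E. *)
Definition radon_nikodym_cocycle (rho : X * X -> R) : Prop :=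
  [/\ measurable_fun E rho,
      (forall p, E p -> 0 < rho p),
      (forall x y z, E (z, y) -> E (y, x) ->
        rho (z, y) * rho (y, x) = rho (z, x)) &
      forall h : X * X -> \bar R, measurable_fun E h ->
        (forall p, E p -> (0 <= h p)%E) ->
        (\int[mu]_x (\esum_(y in xsection E x) h (x, y))%R =
         \int[mu]_x (\esum_(y in xsection E x)
                       (h (y, x) * (rho (y, x))%:E)%E)%R)%E].

Definition smooth_on (A : set X) : Prop :=
  exists S : set X, [/\ measurable S, S `<=` A &
    forall x, A x -> exists! y, S y /\ E (x, y)].

Definition nowhere_smooth : Prop :=
  ~ exists A : set X, [/\ measurable A, invariant_set A, (0 < mu A)%E &
                         smooth_on A].

End EquivalenceRelation.

Section Barytropic.
Variables (R : realType) (X : choiceType) (rho : X * X -> R) (T : rel X).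

(* For D included in the class of x. *)
Definition rho_infinite (x : X) (D : set X) : Prop :=
  (\esum_(y in D) (rho (y, x))%:E)%R = +oo%E.

Definition barytropic (x : X) (xi : set (nat -> X)) : Prop :=
  forall U, half_space T U -> in_closure U xi -> rho_infinite x U.

Definition barytropic_ends (x : X) : set (set (nat -> X)) :=
  [set xi | ends T x xi /\ barytropic x xi].

End Barytropic.

Section Function.
Variables (R : realType) (d : measure_display) (X : measurableType d).
Variables (mu : probability X R) (f : X -> X).

Definition acyclic : Prop :=
  forall (n : nat) (x : X), (1 <= n)%N -> iter n f x <> x.

Definition countable_to_one : Prop :=
  forall y : X, countable (f @^-1` [set y]).

Definition graph_of : rel X := [rel x y | (f x == y) || (f y == x)].

Definition E_of : set (X * X) := connectedness graph_of.

Definition monobarytropic (rho : X * X -> R) : Prop :=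
  {ae mu, forall x, barytropic_ends rho graph_of x #= `I_1}.

Definition dibarytropic (rho : X * X -> R) : Prop :=
  {ae mu, forall x, barytropic_ends rho graph_of x #= `I_2}.

Definition polybarytropic (rho : X * X -> R) : Prop :=
  {ae mu, forall x, `I_3 #<= barytropic_ends rho graph_of x}.

Definition ae_essentially_ended (n : nat) : Prop :=
  exists N : set X, [/\ measurable N, mu N = 0%E, invariant_set E_of N &
                       essentially_ended graph_of (~` N) n].

Definition nowhere_essentially_finitely_ended : Prop :=
  ~ exists (A : set X) (n : nat),
      [/\ measurable A, invariant_set E_of A, (0 < mu A)%E &
          essentially_ended graph_of A n].

End Function.

(* Main.v *)
From mathcomp Require Import finmap.
From mathcomp Require Import all_boot all_order all_algebra.
From mathcomp Require Import all_classical all_reals all_analysis.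
From mathcomp Require Import measurable_realfun zify.
Require Import Defs.

Set Implicit Arguments.
Unset Strict Implicit.
Unset Printing Implicit Defensive.

Import Order.TTheory GRing.Theory Num.Theory.
Local Open Scope classical_set_scope.
Local Open Scope ring_scope.
Local Open Scope card_scope.

(** Every class of [E_of f] carries a forward end, represented by all forward
    orbits; the other ends of its tree are represented by backward rays, the
    sequences [r] with [f (r n.+1) = r n].  The sets [back f x] of the points
    whose orbit passes through [x] and their complements in the class are the
    half-spaces, so the forward end is barytropic when all the complements have
    infinite mass, and the end of [r] is barytropic when [back f (r n)] has
    infinite mass for all [n].  Call [x] heavy if [back f x] has infinite mass.
    The heavy points form a forward closed set, and counting barytropic ends
    means counting the backward rays that consist of heavy points.

    The main tool is [mass_transport]: if every [x] sends the mass [rho (y, x)]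
    to each [y] with [D (x, y)], then [y] receives the mass 1 from each of its
    senders.  So if the mass sent is bounded, almost every [y] has finitely many
    senders, and if every [y] has at most one sender, almost every [x] sends a
    finite mass.  It is used with [finite_section_null]: a Borel set with
    finitely many points in each class is null, since the relation is nowhere
    smooth.  Together they show that, almost everywhere,
    - the forward end is barytropic ([forward_half_infinite]);
    - an orbit visits finitely often a set of points with a bounded mass behind
      them ([light_visits_finite]);
    - the points outside a forward closed set that meets their class are not
      heavy ([light_outside]);
    - a class without heavy points contains a nonempty forward closed set
      without backward rays ([light_one_ended]).

    A forward closed Borel set [Y] contains a Borel set, its backward core [Z],
    that contains all the backward rays in [Y] and in which almost every point
    has a predecessor ([backward_core]).  A class meets [Z] in the empty set, in
    a line or in a set where two points have the same image, according as [Y]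
    contains zero, one or more backward ends in this class.

    With the heavy points as [Y], this splits almost all of [X] into an
    essentially one-ended part with one barytropic end, an essentially
    two-ended part with two, and a rest with at least three ([ae_classify]).
    Conversely, let [Y] witness that an invariant set is essentially [n]-ended.
    Almost everywhere [Y] is forward closed, because its exit points form a
    transversal, and it contains the heavy points of the classes that it meets.
    If [Z] branched, the last branching point of an orbit would give a
    transversal, as there are finitely many ends; so [Z] is empty or a line,
    [n] is 1 or 2, and there are [n] barytropic ends ([essentially_ended_ae]).
    The three equivalences follow by comparing the two statements.

    All this needs sums over classes to be measurable, hence an enumeration of
    the classes by countably many measurable functions.  It exists outside a
    null set ([measurable_enumeration]): by inner regularity, [f] has measurable
    sections on compact sets on which it behaves continuously, and since
    saturations of null sets are null, the images of these sections exhaust [X]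
    up to a null set. *)

(** * The tree of an acyclic function *)

Section Orbits.
Variables (d : measure_display) (X : measurableType d) (f : X -> X).
Hypothesis facyc : acyclic f.
Local Notation T := (graph_of f).
Local Notation E := (E_of f).

Definition forward_closed (Y : set X) := forall x, Y x -> Y (f x).
Definition back (x : X) : set X := [set y | exists n, iter n f y = x].
Definition orbit (x : X) : nat -> X := fun n => iter n f x.
Definition backray (r : nat -> X) := forall n, f (r n.+1) = r n.

Lemma iter_acyclic_inj x m n : iter m f x = iter n f x -> m = n.
Proof.
wlog mn : m n / (m <= n)%N => [hw|].
  by case/orP: (leq_total m n) => h /esym e; [symmetry|]; apply/esym; apply: hw.
rewrite -(subnK mn) iterD => e; have [->|h] := posnP (n - m) => //.
by case: (facyc h (esym e)).
Qed.

Lemma iter_eq_add (x y : X) m n k :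
  iter m f x = iter n f y -> iter (k + m) f x = iter (k + n) f y.
Proof. by rewrite !iterD => ->. Qed.

Lemma E_ofP x y : E (x, y) <-> exists m n, iter m f x = iter n f y.
Proof.
split.
  case=> p /=; elim: p x => [x _ ->|a p IH x /=]; first by exists 0, 0.
  case/andP => xa /IH h /h [m [n e]]; case/orP: xa => /eqP xa.
    by exists m.+1, n; rewrite iterSr xa.
  case: m e => [|m] /= e; first by exists 0, n.+1 => /=; rewrite -e -xa.
  by exists m, n; rewrite -e -xa -iterSr.
move=> [m [n e]].
have up z k : E (z, iter k f z) /\ E (iter k f z, z).
  elim: k => [|k [[p pp pe] [q qq qe]]]; first by split; exists [::].
  split.
    exists (rcons p (f (iter k f z))); last by rewrite last_rcons.
    by rewrite rcons_path pp -pe /= /graph_of /= eqxx.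
  by exists (iter k f z :: q) => //=; rewrite qq /graph_of /= eqxx orbT.
have [[p pp pe] _] := up x m; have [_ [q qq qe]] := up y n.
exists (p ++ q); last by rewrite last_cat -pe e.
by rewrite cat_path pp -pe /= e.
Qed.

Lemma E_refl x : E (x, x). Proof. by apply/E_ofP; exists 0, 0. Qed.
Lemma E_sym x y : E (x, y) -> E (y, x).
Proof. by case/E_ofP => m [n e]; apply/E_ofP; exists n, m. Qed.
Lemma E_trans y x z : E (x, y) -> E (y, z) -> E (x, z).
Proof.
case/E_ofP => m [n e] /E_ofP[k [l e']]; apply/E_ofP.
exists (k + m)%N, (n + l)%N.
by rewrite (iter_eq_add k e) addnC (iter_eq_add n e').
Qed.
Lemma E_iter x n : E (x, iter n f x).
Proof. by apply/E_ofP; exists n, 0. Qed.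
Lemma E_f x : E (x, f x). Proof. exact: (E_iter x 1). Qed.
Lemma E_back x y : back x y -> E (x, y).
Proof. by case=> n <-; apply/E_sym/E_iter. Qed.

Lemma forward_closed_iter Y x n : forward_closed Y -> Y x -> Y (iter n f x).
Proof. by move=> h Yx; elim: n => //= n; exact: h. Qed.

(** Closure under [f] inside one class: a convex set is forward closed on almost
    every class, but possibly not on all of them. *)
Definition forward_closed_at (x : X) (Y : set X) :=
  forall z, E (x, z) -> Y z -> Y (f z).

Lemma forward_closed_all Y x : forward_closed Y -> forward_closed_at x Y.
Proof. by move=> h z _; exact: h. Qed.

Lemma forward_closed_at_E x y Y : E (x, y) -> forward_closed_at x Y ->
  forward_closed_at y Y.
Proof. by move=> xy h z yz; apply: h; exact: E_trans xy yz. Qed.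

Lemma forward_closed_at_iter Y x n : forward_closed_at x Y -> Y x -> Y (iter n f x).
Proof. by move=> h Yx; elim: n => //= n; apply: h; exact: E_iter. Qed.

(** The first point of the orbit of [x] that lies on the orbit of [y]. *)
Lemma meet_minimal x y : E (x, y) -> exists m n, iter m f x = iter n f y /\
  forall i j, (i <= m)%N -> iter i f x = iter j f y -> i = m /\ j = n.
Proof.
case/E_ofP => m0 [n0 e0].
pose P m := `[< exists n, iter m f x = iter n f y >].
have Pex : exists m, P m by exists m0; apply/asboolP; exists n0.
case: (ex_minnP Pex) => m /asboolP[n e] hm; exists m, n; split=> // i j im eij.
have mi : (m <= i)%N by apply: hm; apply/asboolP; exists j.
have im' : i = m by apply/eqP; rewrite eqn_leq im mi.
split=> //; apply: (@iter_acyclic_inj y); by rewrite -eij -e im'.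
Qed.

Lemma inducedT : induced T setT = T.
Proof. by apply/funext=> x; apply/funext => y; rewrite /induced /= !mem_set. Qed.

Lemma inducedP (Y : set X) x y :
  reflect [/\ Y x, Y y & T x y] (induced T Y x y).
Proof.
apply: (iffP and3P) => [[/set_mem ? /set_mem ? ?]|[? ? ?]] //.
by split => //; exact: mem_set.
Qed.

Lemma graph_up x : T x (f x). Proof. by rewrite /graph_of /= eqxx. Qed.
Lemma graph_down x : T (f x) x. Proof. by rewrite /graph_of /= eqxx orbT. Qed.
Lemma graphP x y : T x y -> f x = y \/ f y = x.
Proof. by case/orP => /eqP; [left|right]. Qed.

Lemma joined_sub (Y : set X) x y : joined (induced T Y) x y -> E (x, y).
Proof.
case=> p pp pe; exists p => //=; apply: sub_path pp => u v.
by case/inducedP.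
Qed.

Lemma joined_induced (Y : set X) x y m n : iter m f x = iter n f y ->
  (forall k, (k <= m)%N -> Y (iter k f x)) ->
  (forall k, (k <= n)%N -> Y (iter k f y)) -> joined (induced T Y) x y.
Proof.
have up z k : (forall l, (l <= k)%N -> Y (iter l f z)) ->
  joined (induced T Y) z (iter k f z) /\ joined (induced T Y) (iter k f z) z.
  elim: k => [|k IH] h; first by split; exists [::].
  have [l lk|[p pp pe] [q qq qe]] := IH; first by apply: h; rewrite ltnW.
  split.
    exists (rcons p (f (iter k f z))); last by rewrite last_rcons.
    rewrite rcons_path pp -pe; apply/inducedP; split.
    - exact: h. - exact: (h k.+1). - exact: graph_up.
  exists (iter k f z :: q) => //=; rewrite qq andbT; apply/inducedP; split.
  - exact: (h k.+1). - exact: h. - exact: graph_down.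
move=> e hx hy.
have [[p pp pe] _] := up _ _ hx; have [_ [q qq qe]] := up _ _ hy.
exists (p ++ q); last by rewrite last_cat -pe e.
by rewrite cat_path pp -pe /= e.
Qed.

Lemma invariant_iter (A : set X) x n : invariant_set E A -> A x -> A (iter n f x).
Proof. by move=> h; apply: h; exact: E_iter. Qed.

Lemma joined_invariant (A : set X) x y :
  invariant_set E A -> A x -> E (x, y) -> joined (induced T A) x y.
Proof.
move=> hA Ax xy; have Ay := hA _ _ xy Ax; case/E_ofP: xy => m [n e].
by apply: (joined_induced e) => k _; exact: invariant_iter.
Qed.

Lemma joined_forward (Y : set X) x y :
  forward_closed_at x Y -> Y x -> Y y -> E (x, y) -> joined (induced T Y) x y.
Proof.
move=> hY Yx Yy xy; have hy := forward_closed_at_E xy hY.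
case/E_ofP: xy => m [n e].
by apply: (joined_induced e) => k _; exact: forward_closed_at_iter.
Qed.

(** A duplicate-free path that has gone down an edge cannot go up again, since
    the point above is the one it comes from; so its points are met in reverse
    order on the orbit of its last point. *)
Lemma path_down a p x : path T x (a :: p) -> uniq (x :: a :: p) -> f a = x ->
  forall z, z \in x :: a :: p -> exists k, iter k f (last a p) = z.
Proof.
elim: p a x => [|b p IH] a x.
  move=> _ _ /= fa z; rewrite !inE => /orP[]/eqP ->; first by exists 1.
  by exists 0.
move=> pp up fa z.
have fb : f b = a.
  case/and3P: pp => _ /graphP[|//] fab _; move: up => /=.
  by rewrite -fab fa !inE eqxx !orbT.
have h : forall z, z \in a :: b :: p -> exists k, iter k f (last b p) = z.
  by apply: IH fb; [case/andP: pp|case/andP: up].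
rewrite inE => /orP[/eqP ->|]; last exact: h.
have [k e] : exists k, iter k f (last b p) = a by apply: h; rewrite inE eqxx.
by exists k.+1; rewrite /= e.
Qed.

(** A duplicate-free path goes up for a while and then down. *)
Lemma path_geodesic x p : path T x p -> uniq (x :: p) ->
  forall z, z \in p -> (exists k, iter k f x = z) \/
                       (exists k, iter k f (last x p) = z).
Proof.
elim: p x => [//|a p IH] x pp up z zp.
have [fx|fa] : f x = a \/ f a = x by case/andP: pp => /graphP.
  move: zp; rewrite inE => /orP[/eqP ->|zp]; first by left; exists 1.
  case: (IH a _ _ z zp); [by case/andP: pp|by case/andP: up| |by right].
  by case=> k e; left; exists k.+1; rewrite iterSr fx.
by right; apply: (path_down pp up fa); rewrite inE zp orbT.
Qed.

Lemma forward_closed_convex (A Y : set X) :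
  forward_closed Y -> graph_convex (induced T A) Y.
Proof.
move=> hY x p pp up Yx Yl z zp.
have pp' : path T x p by apply: sub_path pp => u v; case/inducedP.
by case: (path_geodesic pp' up zp) => -[k <-]; exact: forward_closed_iter.
Qed.

Lemma traject_uniq z k : uniq (traject f z k).
Proof.
elim: k => // k IH; rewrite trajectSr rcons_uniq IH andbT.
by apply/trajectP => -[i ik /iter_acyclic_inj ki]; rewrite ki ltnn in ik.
Qed.

(** The geodesic from [x] to [y] goes up to the point where the two orbits meet
    and then down to [y].  If it goes up at all, it contains [f x]. *)
Lemma convex_exit_up (A Y : set X) x y : invariant_set E A ->
  Y `<=` A -> graph_convex (induced T A) Y -> E (x, y) ->
  Y x -> Y y -> ~ Y (f x) -> exists n, iter n f y = x.
Proof.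
move=> hA YA cY xy Yx Yy nYx.
have [m [n [e hmin]]] := meet_minimal xy.
case: m e hmin => [|m] e hmin; first by exists n.
pose q := rev (traject f y n); pose p := traject f (f x) m.+1 ++ q.
have Ax := YA _ Yx; have Ay := YA _ Yy.
have pp : path (induced T A) x p.
  rewrite /p cat_path; apply/andP; split.
    elim: m.+1 x Ax {e hmin p q Yx nYx xy} => //= k IH x Ax.
    have Afx : A (f x) by apply: hA Ax; exact: E_f.
    rewrite IH ?andbT //; apply/inducedP; split=> //; exact: graph_up.
  have -> : last x (traject f (f x) m.+1) = iter n f y.
    by rewrite -e last_traject iterSr.
  rewrite /q; elim: n {e hmin p q} => [//|n IH].
  rewrite trajectSr rev_rcons /= IH andbT; apply/inducedP; split.
  - exact: (invariant_iter n.+1). - exact: invariant_iter. - exact: graph_down.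
have lp : last x p = y.
  rewrite /p /q last_cat; case: n e {hmin p q pp} => [|n] e.
    by rewrite /= last_traject -iterSr.
  by rewrite /= rev_cons last_rcons.
have up : uniq (x :: p).
  rewrite /p -cat_cons -/(traject f x m.+2) cat_uniq traject_uniq rev_uniq.
  rewrite traject_uniq andbT /=.
  apply/hasPn => z; rewrite mem_rev => /trajectP[j jn ->].
  apply/negP => h; have {h} : iter j f y \in traject f x m.+2 by [].
  case/trajectP => i im /esym /hmin[//|_ jn'].
  by rewrite jn' ltnn in jn.
case: nYx; apply: (cY _ _ pp up Yx); first by rewrite lp.
by rewrite inE eqxx.
Qed.

(** The points where [f] leaves a convex set form a partial transversal; this
    will make them negligible. *)
Lemma convex_exit_unique (A Y : set X) x y : invariant_set E A ->
  Y `<=` A -> graph_convex (induced T A) Y -> E (x, y) ->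
  Y x -> ~ Y (f x) -> Y y -> ~ Y (f y) -> x = y.
Proof.
move=> hA YA cY xy Yx nYx Yy nYy.
have [m e] := convex_exit_up hA YA cY xy Yx Yy nYx.
have [n e'] := convex_exit_up hA YA cY (E_sym xy) Yy Yx nYy.
have : iter (n + m) f y = iter 0 f y by rewrite iterD e e'.
by move/iter_acyclic_inj; case: m e => // m _; rewrite addnS.
Qed.

(** * Rays and ends *)

Lemma tail_equiv_refl (r : nat -> X) : tail_equiv r r.
Proof. by exists 0, 0. Qed.
Lemma tail_equiv_sym (r s : nat -> X) : tail_equiv r s -> tail_equiv s r.
Proof. by case=> m [n h]; exists n, m => k; rewrite h. Qed.
Lemma tail_equiv_trans (s r t : nat -> X) :
  tail_equiv r s -> tail_equiv s t -> tail_equiv r t.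
Proof.
case=> m [n h] [m' [n' h']]; exists (m + m')%N, (n' + n)%N => k.
by rewrite -addnA h -addnA -h'; congr s; lia.
Qed.
Lemma tail_equiv_shift (r : nat -> X) N : tail_equiv r (fun n => r (N + n)%N).
Proof. by exists N, 0. Qed.

Lemma backray_iter r k n : backray r -> iter k f (r (k + n)%N) = r n.
Proof. by move=> h; elim: k => // k IH; rewrite iterSr addSn h. Qed.

Lemma backray_class x r n : backray r -> E (x, r 0%N) -> E (x, r n).
Proof.
move=> hr xr; apply: (E_trans xr); apply: E_back; exists n.
by have := backray_iter n 0 hr; rewrite addn0.
Qed.

Lemma backray_shift r N : backray r -> backray (fun n => r (N + n)%N).
Proof. by move=> h n; rewrite addnS. Qed.

Lemma backray_inj r : backray r -> injective r.
Proof.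
move=> h m n; wlog mn : m n / (m <= n)%N => [hw|].
  by case/orP: (leq_total m n) => ? e; [|symmetry]; apply: hw.
move=> e; have := backray_iter (n - m) m h; rewrite subnK // -e => e'.
by have := @iter_acyclic_inj _ _ 0 e'; lia.
Qed.

(** Once a ray goes down it goes down forever, because a step up would revisit
    the previous point. *)
Lemma ray_shape r : geodesic_ray T r ->
  r = orbit (r 0%N) \/ exists N, backray (fun n => r (N + n)%N).
Proof.
case=> rinj rT; have [h|/existsNP[N hN]] := pselect (forall n, f (r n) = r n.+1).
  by left; apply/funext; elim=> // n IH; rewrite -h IH.
right; exists N; elim=> [|n IH]; first by rewrite addn0 addn1; case/graphP: (rT N).
rewrite !addnS; case/graphP: (rT (N + n).+1) => // e.
rewrite addnS in IH; rewrite IH in e; by move/rinj: e; lia.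
Qed.

Lemma orbit_ray Y x : forward_closed_at x Y -> Y x -> geodesic_ray (induced T Y) (orbit x).
Proof.
move=> hY Yx; split=> [m n /iter_acyclic_inj //|n].
apply/inducedP; split; [exact: forward_closed_at_iter|exact: (@forward_closed_at_iter Y x n.+1)|].
exact: graph_up.
Qed.

Lemma backray_ray (Y : set X) r :
  backray r -> (forall n, Y (r n)) -> geodesic_ray (induced T Y) r.
Proof.
move=> hr Yr; split; first exact: backray_inj.
by move=> n; apply/inducedP; split=> //; rewrite -{1}hr; exact: graph_down.
Qed.

Lemma ray_sub Y r : geodesic_ray (induced T Y) r ->
  geodesic_ray T r /\ forall n, Y (r n).
Proof.
by case=> rinj h; split=> [|n]; [split=> // n|]; case/inducedP: (h n).
Qed.

Lemma end_of_eq (T' : rel X) r s : tail_equiv r s -> end_of T' r = end_of T' s.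
Proof.
move=> rs; apply/seteqP; split=> t [gt tt]; split=> //.
  exact: tail_equiv_trans (tail_equiv_sym rs) tt.
exact: tail_equiv_trans rs tt.
Qed.

Lemma end_of_inj (T' : rel X) r s :
  geodesic_ray T' s -> end_of T' r = end_of T' s -> tail_equiv r s.
Proof.
move=> gs e; have [//] : end_of T' r s.
by rewrite e; split=> //; exact: tail_equiv_refl.
Qed.

Lemma orbit_tail x y : E (x, y) -> tail_equiv (orbit x) (orbit y).
Proof.
case/E_ofP => m [n e]; exists m, n => k; rewrite /orbit.
by rewrite addnC (iter_eq_add k e) addnC.
Qed.

Lemma orbit_not_back x r : backray r -> ~ tail_equiv (orbit x) r.
Proof.
move=> hr [m [n h]]; have := h 0%N; have := h 2%N; rewrite !addn0 /orbit => e1 e2.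
have := backray_iter 2 n hr; rewrite [(2 + n)%N]addnC -e1 -e2 -iterD.
by move/iter_acyclic_inj; lia.
Qed.

Lemma ends_cases Y x xi : forward_closed_at x Y -> Y x -> ends (induced T Y) x xi ->
  xi = end_of (induced T Y) (orbit x) \/
  exists r, [/\ backray r, forall n, Y (r n), E (x, r 0%N)
              & xi = end_of (induced T Y) r].
Proof.
move=> hY Yx [r [gr xr ->]]; have [gr' Yr] := ray_sub gr.
have Exr := joined_sub xr.
have [e|[N hN]] := ray_shape gr'.
  left; rewrite e; apply: end_of_eq; exact/orbit_tail/E_sym.
right; exists (fun n => r (N + n)%N); split=> //; last first.
  exact/end_of_eq/tail_equiv_shift.
apply: (E_trans Exr); rewrite addn0.
elim: N {hN} => [|N IH]; first exact: E_refl.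
apply: (E_trans IH); have [_ /(_ N)/graphP[<-|<-]] := gr'; first exact: E_f.
exact/E_sym/E_f.
Qed.

Lemma ends_orbit Y x : forward_closed_at x Y -> Y x ->
  ends (induced T Y) x (end_of (induced T Y) (orbit x)).
Proof.
move=> hY Yx; exists (orbit x); split=> //; first exact: orbit_ray.
by exists [::].
Qed.

Lemma ends_back Y x r : forward_closed_at x Y -> Y x -> backray r ->
  (forall n, Y (r n)) -> E (x, r 0%N) ->
  ends (induced T Y) x (end_of (induced T Y) r).
Proof.
move=> hY Yx hr Yr xr; exists r; split=> //; first exact: backray_ray.
exact: joined_forward.
Qed.

Lemma backray_tail_meet r s : backray r -> backray s -> tail_equiv r s ->
  exists p a b, iter a f p = r 0%N /\ iter b f p = s 0%N.
Proof.
move=> hr hs [m [n h]]; exists (r m), m, n; split.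
  by rewrite -[in r m](addn0 m) backray_iter.
by have := h 0%N; rewrite addn0 => ->; rewrite backray_iter.
Qed.

Lemma siblings_not_tail r s : backray r -> backray s -> f (r 0%N) = f (s 0%N) ->
  r 0%N <> s 0%N -> ~ tail_equiv r s.
Proof.
move=> hr hs e ne /(backray_tail_meet hr hs)[p [a [b [ea eb]]]].
apply: ne; rewrite -ea -eb; congr iter.
by apply: eq_add_S; apply: (@iter_acyclic_inj p); rewrite /= ea eb.
Qed.

(** A common point of two equivalent rays has both starting points on its
    orbit, and comparing heights identifies the start of the upper ray with a
    point of the orbit of [x]. *)
Lemma leaving_not_tail x r s k l : (k < l)%N -> backray r -> backray s ->
  f (r 0%N) = iter k f x -> f (s 0%N) = iter l f x ->
  s 0%N <> iter l.-1 f x -> ~ tail_equiv r s.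
Proof.
move=> kl hr hs er es ne /(backray_tail_meet hr hs)[p [a [b [ea eb]]]].
have e1 : iter a.+1 f p = iter k f x by rewrite /= ea.
have e2 : iter b.+1 f p = iter l f x by rewrite /= eb.
have e3 := iter_eq_add (l - k) e1; rewrite subnK ?(ltnW kl) // in e3.
have eb' : b = (l - k + a)%N.
  by have := @iter_acyclic_inj p b.+1 (l - k + a.+1)%N; rewrite e2 e3 => /(_ erefl); lia.
apply: ne; rewrite -eb eb'.
have -> : (l - k + a = (l - k).-1 + a.+1)%N by lia.
by rewrite (iter_eq_add _ e1); congr iter; lia.
Qed.

(** Where [f] is injective there is only one way to go backwards. *)
Lemma line_tail (Z : set X) r s : {in Z &, injective f} -> forward_closed Z ->
  backray r -> backray s -> (forall n, Z (r n)) -> (forall n, Z (s n)) ->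
  E (r 0%N, s 0%N) -> tail_equiv r s.
Proof.
move=> fZ hZ hr hs Zr Zs rs.
have injZ n x y : Z x -> Z y -> iter n f x = iter n f y -> x = y.
  elim: n x y => // n IH x y Zx Zy; rewrite !iterSr => /IH h.
  by apply: fZ; rewrite ?inE //; apply: h; exact: hZ.
have aux r' s' k : backray r' -> backray s' -> (forall n, Z (r' n)) ->
    (forall n, Z (s' n)) -> iter k f (s' 0%N) = r' 0%N -> tail_equiv r' s'.
  move=> hr' hs' Zr' Zs' e; exists k, 0%N => j; rewrite add0n.
  apply: (@injZ (k + j)%N) => //.
  have := backray_iter (k + j) 0 hr'; rewrite addn0 => ->.
  by rewrite iterD; have := backray_iter j 0 hs'; rewrite addn0 => ->.
have [m [n e]] : exists m n, iter m f (r 0%N) = iter n f (s 0%N) by apply/E_ofP.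
case/orP: (leq_total m n) => mn.
  apply: (aux r s (n - m)%N) => //; apply: (injZ m) => //.
    exact: forward_closed_iter.
  by rewrite -iterD subnKC.
apply/tail_equiv_sym/(aux s r (m - n)%N) => //; apply: (injZ n) => //.
  exact: forward_closed_iter.
by rewrite -iterD subnKC.
Qed.

Lemma backray_exists (Z : set X) x : (forall y, Z y -> exists2 z, Z z & f z = y) ->
  Z x -> exists r, [/\ backray r, forall n, Z (r n) & r 0%N = x].
Proof.
move=> h Zx.
have [g hg] : exists g : X -> X, forall y, Z y -> Z (g y) /\ f (g y) = y.
  have /choice[g hg] : forall y, exists z, Z y -> Z z /\ f z = y.
    move=> y; have [Zy|nZy] := pselect (Z y); last by exists y.
    by have [z Zz e] := h y Zy; exists z.
  by exists g.
have Zi n : Z (iter n g x) by elim: n => //= n; case/hg.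
by exists (fun n => iter n g x); split=> // n /=; case: (hg _ (Zi n)).
Qed.

(** * Half-spaces *)

Lemma half_space_edge U u v u' v' : half_space T U ->
  U u -> ~ U v -> T u v -> U u' -> ~ U v' -> T u' v' -> u = u' /\ v = v'.
Proof.
case=> _ [e [_ he]] h1 h2 h3 h4 h5 h6.
have e1 := he (u, v) (And3 h1 h2 h3); have e2 := he (u', v') (And3 h4 h5 h6).
by move: e1; rewrite e2 => -[-> ->].
Qed.

(** Let [(u, v)] be the boundary edge of [U].  Every orbit of the class is
    eventually in [U], and it can enter [U] only by passing through [v]. *)
Lemma half_space_forward U x : half_space T U ->
  in_closure U (end_of T (orbit x)) ->
  exists z, E (x, z) /\ [set y | E (x, y)] `\` back z `<=` U.
Proof.
move=> hU [s [gs [m [n h]]] Us].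
have Uo k : U (iter (m + k)%N f x) by rewrite -/(orbit x (m + k)%N) h.
have enter y : E (x, y) -> ~ U y -> exists k, ~ U (iter k f y) /\ U (iter k.+1 f y).
  move=> /E_ofP[a [b e]] nUy.
  have [k0 hk0] : exists k, U (iter k f y).
    by exists (m + b)%N; rewrite -(iter_eq_add m e).
  have hP : exists k, `[<U (iter k f y)>] by exists k0; apply/asboolP.
  case: (ex_minnP hP) => k /asboolP Uk hk.
  case: k Uk hk => [//|k] Uk hk; exists k; split=> // /asboolP/hk.
  by rewrite ltnn.
have edge : exists u v, [/\ U u, ~ U v & T u v].
  by case: hU => _ [[u v] [[? ? ?] _]]; exists u, v.
case: edge => u [v [Uu nUv uv]].
have Exu : E (x, u).
  have [p pp pe] := proj1 hU _ _ (Uo 0%N) Uu.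
  apply: E_trans (E_iter x (m + 0)) _.
  by apply: (@joined_sub U); exists p.
have Exv : E (x, v).
  apply: (E_trans Exu); case/graphP: uv => <-; first exact: E_f.
  exact/E_sym/E_f.
exists v; split=> // y [xy nby]; apply: contrapT => nUy; apply: nby.
have [k [nk Uk]] := enter _ xy nUy.
have [_ <-] := half_space_edge hU Uk nk (graph_down _) Uu nUv uv.
by exists k.
Qed.

(** Let [(u, v)] be the boundary edge of [U].  An orbit that starts outside [U]
    and reaches a point of the ray in [U] passes through [v] on its way; but [v]
    is not behind the points of the ray that are far enough. *)
Lemma half_space_backray U r : half_space T U -> backray r ->
  in_closure U (end_of T r) -> exists n, back (r n) `<=` U.
Proof.
move=> hU hr [s [gs [m [n h]]] Us].
have Ur k : U (r (m + k)%N) by rewrite h.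
case: hU (hU) => _ [[u v] [[/= Uu nUv uv] _]] hU.
have [k hk] : exists k, ~ back (r (m + k)%N) v.
  apply: contrapT => /forallNP hb.
  have {}hb k : back (r (m + k)%N) v by apply: contrapT; exact: hb.
  have [a ea] := hb 0%N; have [b eb] := hb a.+1.
  have := backray_iter a.+1 m hr; rewrite addnC -eb -iterD -{1}(addn0 m) -ea.
  by move/iter_acyclic_inj; lia.
exists (m + k)%N => y [a ea]; apply: contrapT => nUy; apply: hk.
have hP : exists j, `[<U (iter j f y)>].
  by exists a; apply/asboolP; rewrite ea.
case: (ex_minnP hP) => j /asboolP Uj hj.
have ja : (j <= a)%N by apply: hj; apply/asboolP; rewrite ea.
case: j Uj hj ja => [//|j] Uj hj ja.
have nj : ~ U (iter j f y) by move/asboolP/hj; rewrite ltnn.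
have [_ <-] := half_space_edge hU Uj nj (graph_down _) Uu nUv uv.
by exists (a - j)%N; rewrite -iterD subnK // ltnW.
Qed.

Lemma half_space_back x : half_space T (back x).
Proof.
have bU a y : iter a f y = x -> forall k, (k <= a)%N -> back x (iter k f y).
  by move=> e k ka; exists (a - k)%N; rewrite -iterD subnK.
split.
  move=> y z [a ea] [b eb].
  by apply: (@joined_induced _ _ _ a b); [rewrite ea eb|exact: bU|exact: bU].
exists (x, f x); split.
  split=> /=; [by exists 0%N| |exact: graph_up].
  by case=> n; rewrite -iterSr => /(facyc (isT : (1 <= n.+1)%N)).
move=> [u v] [/= [a ea] nv /graphP[uv|vu]]; last first.
  by case: nv; exists a.+1; rewrite iterSr vu.
case: a ea => [|a] ea; first by rewrite -uv -ea.
by case: nv; exists a; rewrite -uv -iterSr.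
Qed.

Lemma in_closure_back r n : backray r -> in_closure (back (r n)) (end_of T r).
Proof.
move=> hr; exists (fun k => r (n + k)%N).
  split; last exact: tail_equiv_shift.
  rewrite -inducedT; apply: backray_ray => //; exact: backray_shift.
by move=> k; exists k; rewrite addnC backray_iter.
Qed.

End Orbits.

(** * Finite sets, sums and the number of ends *)

Lemma finite_set_bounded (X : choiceType) (A : set X) (h : X -> nat) :
  finite_set A -> exists m, forall x, A x -> (h x <= m)%N.
Proof.
case/finite_fsetP => B ->; exists (\max_(x <- B) h x)%N => x xB.
exact: leq_bigmax_seq.
Qed.

Lemma finite_decreasing (X : choiceType) (A : set X) (B : nat -> set X) :
  finite_set A -> (forall n, B n `<=` A) -> (forall n, B n.+1 `<=` B n) ->
  (forall n, B n !=set0) -> \bigcap_n B n !=set0.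
Proof.
move=> fA BA dB nB; apply: contrapT => nI.
have /choice[h hh] : forall x, exists n, ~ B n x.
  move=> x; apply: contrapT => /forallNP h; apply: nI; exists x => n _.
  by apply: contrapT; exact: h.
have [m hm] := finite_set_bounded h fA.
have [x Bx] := nB m; apply: (hh x).
have dBk n k : B (k + n)%N `<=` B n.
  by elim: k => [//|k IH]; exact: subset_trans (dB _) IH.
have := hm x (BA _ _ Bx) => le; apply: (dBk _ (m - h x)%N).
by rewrite subnK.
Qed.

Section SumTools.
Context (R : realType) (X : choiceType).
Implicit Types (A B : set X) (a : X -> \bar R).

Lemma esum_subset A B a : A `<=` B -> (\esum_(y in A) a y <= \esum_(y in B) a y)%E.
Proof.
move=> AB; apply: le_ereal_sup => _ [F [fF FA] <-]; exists F => //.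
by split=> //; exact: subset_trans AB.
Qed.

Lemma esum_subset_oo A B a : A `<=` B -> \esum_(y in A) a y = +oo%E ->
  \esum_(y in B) a y = +oo%E.
Proof. by move=> /(@esum_subset _ _ a) h e; move: h; rewrite e leye_eq => /eqP. Qed.

Lemma esum_scale_le A (a : X -> R) (c : R) : 0 < c -> (forall y, A y -> 0 <= a y) ->
  (\esum_(y in A) (a y * c)%:E <= c%:E * \esum_(y in A) (a y)%:E)%E.
Proof.
move=> c0 a0; apply: ge_ereal_sup => _ [F [fF FA] <-].
have h : (\sum_(y \in F) (a y)%:E <= \esum_(y in A) (a y)%:E)%E.
  by apply: ereal_sup_ubound; exists F.
apply: le_trans (lee_wpmul2l _ h); last by rewrite lee_fin ltW.
rewrite !fsumEFin // -EFinM lee_fin !fsbig_finite //= mulr_sumr.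
by apply: ler_sum => i _; rewrite mulrC.
Qed.

Lemma esum1_finite A : (\esum_(y in A) (1 : R)%:E < +oo)%E -> finite_set A.
Proof.
move=> h; apply: contrapT => /infinite_set_fset hA; move: h; rewrite ltNge => /negP; apply.
rewrite leye_eq; apply/eqP/eqyP => r r0.
have [n rn] : exists n, r <= n%:R :> R.
  by exists (Num.truncn r).+1; apply: ltW; exact: truncnS_gt.
have [B BA nB] := hA n.
apply: esum_ge; exists [set` B]; first by split=> //; exact: finite_fset.
rewrite fsumEFin // lee_fin fsbig_finite //= set_fsetK.
by rewrite big_const_seq count_predT iter_addr addr0 (le_trans rn) // ler_nat.
Qed.
End SumTools.

Lemma card_eq2 (U : Type) (a b : U) : a <> b -> [set a; b] #= `I_2.
Proof.
move=> ab; apply/eq_cardSP; exists a; first by left.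
rewrite (_ : _ `\ _ = [set b]); first exact: card_set1.
apply/seteqP; split=> [x [[->|->] //]|x ->]; first by case.
by split; [right|move=> /esym].
Qed.

Lemma card_ge3 (U : Type) (S : set U) (a b c : U) : a <> b -> a <> c -> b <> c ->
  S a -> S b -> S c -> `I_3 #<= S.
Proof.
move=> ab ac bc Sa Sb Sc; apply/card_subP; exists [set a; b; c]; last first.
  by move=> x [[->|->]|->].
apply/eq_cardSP; exists a; first by left; left.
rewrite (_ : _ `\ _ = [set b; c]); first exact: card_eq2.
apply/seteqP; split=> x; first by move=> [[[->|->]|->] nx]; [case: (nx erefl)|left|right].
by move=> [->|->]; (split; last by move=> /esym); (try by right); left; right.
Qed.

Lemma card_II_inj (U : Type) (S : set U) m n : S #= `I_m -> S #= `I_n -> m = n.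
Proof. by move=> /card_esym h h'; apply/card_eq_II; exact: (card_eq_trans h h'). Qed.

Lemma card_lt_neq (U : Type) (S : set U) m n : (n < m)%N -> `I_m #<= S -> ~ (S #= `I_n).
Proof.
by move=> nm h /card_le_eqr e; move: h; rewrite e card_le_II leqNgt nm.
Qed.

Section Counting.
Context (d : measure_display) (X : measurableType d) (f : X -> X).
Hypothesis facyc : acyclic f.
Local Notation E := (E_of f).

(** The forward end and the ends of the backward rays in [Y].  Taking for [Y] a
    forward closed set gives all the ends of the graph induced on it, and taking
    the heavy points gives the barytropic ends. *)
Definition ray_ends (T' : rel X) (Y : set X) x : set (set (nat -> X)) :=
  [set xi | xi = end_of T' (orbit f x) \/
     exists r, [/\ backray f r, forall n, Y (r n), E (x, r 0%N) & xi = end_of T' r]].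

Lemma ends_ray_ends Y x : forward_closed_at f x Y -> Y x ->
  ends (induced (graph_of f) Y) x = ray_ends (induced (graph_of f) Y) Y x.
Proof.
move=> hY Yx; apply/seteqP; split=> xi; first exact: ends_cases.
by case=> [->|[r [hr Yr xr ->]]]; [exact: ends_orbit|exact: ends_back].
Qed.

Variables (T' : rel X) (Y : set X) (x : X).
Hypothesis gT : forall r, backray f r -> (forall n, Y (r n)) -> geodesic_ray T' r.

Lemma ray_ends_one : (forall r, backray f r -> (forall n, Y (r n)) -> ~ E (x, r 0%N)) ->
  ray_ends T' Y x #= `I_1.
Proof.
move=> h; rewrite (_ : ray_ends _ _ _ = [set end_of T' (orbit f x)]).
  exact: card_set1.
apply/seteqP; split=> xi; last by move=> ->; left.
by case=> [->//|[r [hr Yr xr _]]]; case: (h r).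
Qed.

Lemma end_orbit_back r : backray f r -> (forall n, Y (r n)) ->
  end_of T' (orbit f x) <> end_of T' r.
Proof.
move=> hr Yr /(end_of_inj (gT hr Yr)); exact: orbit_not_back.
Qed.

Lemma ray_ends_two (Z : set X) : forward_closed_at f x Z ->
  (forall y z, Z y -> Z z -> E (x, y) -> f y = f z -> y = z) ->
  (forall r, backray f r -> (forall n, Y (r n)) -> E (x, r 0%N) -> forall n, Z (r n)) ->
  (exists r, [/\ backray f r, forall n, Y (r n) & E (x, r 0%N)]) ->
  ray_ends T' Y x #= `I_2.
Proof.
move=> hZ iZ rZ [r0 [hr0 Yr0 xr0]].
rewrite (_ : ray_ends _ _ _ = [set end_of T' (orbit f x); end_of T' r0]).
  by apply: card_eq2; exact: end_orbit_back.
apply/seteqP; split=> xi; last first.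
  by case=> ->; [left|right; exists r0].
case=> [->|[r [hr Yr xr ->]]]; [by left|right; apply: end_of_eq].
apply: (@line_tail _ _ f (Z `&` [set y | E (x, y)])) => //.
- move=> y z /set_mem[Zy xy] /set_mem[Zz xz]; exact: iZ.
- move=> y [Zy xy]; split; first exact: hZ.
  exact: E_trans xy (E_f f y).
- by move=> n; split; [exact: rZ|exact: backray_class].
- by move=> n; split; [exact: rZ|exact: backray_class].
- exact: E_trans (E_sym xr) xr0.
Qed.

Lemma ray_ends_three r s : backray f r -> backray f s ->
  (forall n, Y (r n)) -> (forall n, Y (s n)) -> E (x, r 0%N) -> E (x, s 0%N) ->
  ~ tail_equiv r s -> `I_3 #<= ray_ends T' Y x.
Proof.
move=> hr hs Yr Ys xr xs nrs.
apply: (@card_ge3 _ _ (end_of T' (orbit f x)) (end_of T' r) (end_of T' s)).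
- exact: end_orbit_back.
- exact: end_orbit_back.
- by move/(end_of_inj (gT hs Ys)).
- by left.
- by right; exists r.
- by right; exists s.
Qed.

(** Backward rays that leave the orbit of [x] at different heights represent
    different ends. *)
Lemma ray_ends_finite (P : nat -> Prop) : (forall k, P k -> exists r,
    [/\ backray f r, forall n, Y (r n), E (x, r 0%N), f (r 0%N) = iter k f x
      & r 0%N <> iter k.-1 f x]) ->
  finite_set (ray_ends T' Y x) -> exists m, forall k, P k -> (k <= m)%N.
Proof.
move=> hP hfin.
have /choice[h hh] : forall k, exists r, P k ->
    [/\ backray f r, forall n, Y (r n), E (x, r 0%N), f (r 0%N) = iter k f x
      & r 0%N <> iter k.-1 f x].
  move=> k; have [Pk|nP] := pselect (P k); last by exists (fun=> x).
  by have [r hr] := hP k Pk; exists r.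
have fP : finite_set [set k | P k].
  have inj : {in [set k | P k] &, injective (fun k => end_of T' (h k))}.
    move=> k l /set_mem Pk /set_mem Pl e.
    have [hrk Yk xk fk nk] := hh k Pk; have [hrl Yl xl fl nl] := hh l Pl.
    have [kl|lk|//] := ltngtP k l.
      have := leaving_not_tail facyc kl hrk hrl fk fl nl.
      by case; exact: end_of_inj (gT hrl Yl) e.
    have := leaving_not_tail facyc lk hrl hrk fl fk nk.
    by case; apply: end_of_inj (gT hrk Yk) _.
  have : finite_set ((fun k => end_of T' (h k)) @` [set k | P k]).
    apply: sub_finite_set hfin => _ [k Pk <-]; right; exists (h k).
    by have [? ? ? _ _] := hh k Pk; split.
  by rewrite (eq_finite_set (inj_card_eq inj)).
have [m hm] := finite_set_bounded id fP; by exists m.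
Qed.

End Counting.

(** * Measurable enumeration of the classes *)

Lemma measurable_preimage d1 d2 (Y : measurableType d1) (Z : measurableType d2)
  (h : Y -> Z) (A : set Z) : measurable_fun setT h -> measurable A ->
  measurable (h @^-1` A).
Proof. by move=> mh mA; rewrite -[_ @^-1` _]setTI; exact: mh. Qed.

Section MeasureTools.
Context (R : realType) (d : measure_display) (X : measurableType d).
Variable mu : probability X R.

Lemma probability_fin A : measurable A -> (mu A < +oo)%E.
Proof. by move=> mA; apply: le_lt_trans (probability_le1 mu mA) (ltry _). Qed.

Lemma mu_decreasing_small (D : nat -> set X) (e : R) : 0 < e ->
  (forall n, measurable (D n)) -> (forall n, D n.+1 `<=` D n) ->
  mu (\bigcap_n D n) = 0%E -> exists n, (mu (D n) <= e%:E)%E.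
Proof.
move=> e0 mD dD D0.
have niD : nonincreasing_seq D by apply/nonincreasing_seqP => n; exact/subsetPset.
have : mu (D n) @[n --> \oo] --> 0%E.
  rewrite -D0; apply: nonincreasing_cvg_mu => //; first exact: probability_fin.
  exact: bigcapT_measurable.
move=> /fine_cvgP[_ /cvgrPdist_le /(_ e e0)] [n _ /(_ n (leqnn n))].
rewrite /= sub0r normrN => h; exists n.
have fD : mu (D n) \is a fin_num by rewrite ge0_fin_numE ?probability_fin.
by rewrite -(fineK fD) lee_fin; apply: le_trans h; exact: ler_norm.
Qed.

Lemma mu_bigcup_small (A : nat -> set X) (e : R) : 0 < e ->
  (forall n, measurable (A n)) ->
  (forall n, (mu (A n) <= (e / (2 ^ n.+1)%:R)%:E)%E) ->
  (mu (\bigcup_n A n) <= e%:E)%E.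
Proof.
move=> e0 mA hA; apply: le_trans (generalized_Boole_inequality mu mA _) _.
  exact: bigcupT_measurable.
apply: le_trans (epsilon_trick0 xpredT (ltW e0)).
by apply: lee_nneseries => // i _; exact: hA.
Qed.

Lemma half_pow_gt0 (e : R) n : 0 < e -> 0 < e / (2 ^ n.+1)%:R.
Proof. by move=> e0; rewrite divr_gt0// ltr0n expn_gt0. Qed.

(** What is used of the compact subsets of a Polish space, seen in [X].  The
    fourth clause is compactness for decreasing sequences, and the last one is
    inner regularity of [mu]. *)
Definition compact_class (K : set (set X)) :=
  [/\ K `<=` measurable,
      (forall A B, K A -> K B -> K (A `|` B)),
      (forall A : nat -> set X, (forall n, K (A n)) -> K (\bigcap_n A n)),
      (forall A : nat -> set X, (forall n, K (A n)) ->
        (forall n, A n.+1 `<=` A n) -> (forall n, A n !=set0) ->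
        (\bigcap_n A n) !=set0) &
      (forall A, measurable A -> forall e : R, 0 < e ->
        exists C, [/\ K C, C `<=` A & (mu (A `\` C) <= e%:E)%E])].

Section Standard.
Variables (P : completePseudoMetricType R) (phi : X -> P) (U : nat -> set P).
Hypotheses (hP : hausdorff_space P) (phib : bijective phi).
Hypothesis phim : forall A : set X, measurable A <-> <<s [set U : set P | open U] >> (phi @` A).
Hypothesis Ub : forall O x, open O -> O x -> exists n, U n x /\ closure (U n) `<=` O.

Lemma image_preimage_phi (A : set P) : phi @` (phi @^-1` A) = A.
Proof.
case: phib => psi pk kp; apply/seteqP; split=> [y [x Ax <-] //|y Ay].
by exists (psi y); rewrite /= kp.
Qed.

Lemma preimage_measurable A :
  <<s [set U : set P | open U] >> A -> measurable (phi @^-1` A).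
Proof. by move=> h; apply/phim; rewrite image_preimage_phi. Qed.

Lemma preimage_open A : open A -> measurable (phi @^-1` A).
Proof. by move=> oA; apply: preimage_measurable; exact: sub_sigma_algebra. Qed.

Lemma preimage_closed A : closed A -> measurable (phi @^-1` A).
Proof.
move=> cA; rewrite -(setCK A) preimage_setC; apply: measurableC.
exact: (@preimage_open (~` A) (closed_openC cA)).
Qed.

Lemma open_ind (G : set (set X)) : G set0 -> (forall A, G A -> G (~` A)) ->
  (forall A : nat -> set X, (forall n, G (A n)) -> G (\bigcup_n A n)) ->
  (forall O, open O -> G (phi @^-1` O)) -> measurable `<=` G.
Proof.
move=> G0 GC GU GO A /phim mA.
have -> : A = phi @^-1` (phi @` A).
  case: phib => psi pk kp; apply/seteqP; split=> [x Ax|x [y Ay e]]; first by exists x.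
  by rewrite -(pk x) -e pk.
have : smallest (sigma_algebra setT) [set U : set P | open U]
    `<=` [set B | G (phi @^-1` B)].
  apply: smallest_sub; last by move=> O; exact: GO.
  split=> [|B hB|B hB]; rewrite /mkset.
  - exact: G0.
  - by rewrite setTD preimage_setC; exact: GC.
  - by rewrite preimage_bigcup; exact: GU.
exact.
Qed.

(** At each scale, finitely many small sets cover [P] up to a small measure.  The
    set covered at all scales is closed and totally bounded. *)
Lemma tight (e : R) : 0 < e ->
  exists2 C : set P, compact C & (mu (~` (phi @^-1` C)) <= e%:E)%E.
Proof.
move=> e0.
pose small n i := exists c : P, U i `<=` ball c (n.+1%:R^-1 / 2 : R).
pose V n m := [set x | exists i, [/\ (i < m)%N, small n i & closure (U i) x]].
have cV n m : closed (V n m).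
  have -> : V n m = \bigcup_(i in [set i | (i < m)%N /\ small n i]) closure (U i).
    by apply/seteqP; split=> x [i] => [[? ? ?]|[]]; exists i.
  apply: closed_bigcup => //; last by move=> i _; exact: closed_closure.
  by apply: sub_finite_set (finite_II m) => i [].
have mV n m : measurable (~` (phi @^-1` (V n m))).
  by apply: measurableC; exact: preimage_closed.
have /choice[m hm] : forall n, exists m,
    (mu (~` (phi @^-1` (V n m))) <= (e / (2 ^ n.+1)%:R)%:E)%E.
  move=> n; apply: mu_decreasing_small => //; first exact: half_pow_gt0.
    move=> m x nV [i [im si ci]]; apply: nV; exists i; split=> //.
    by rewrite ltnS ltnW.
  rewrite (_ : \bigcap_m _ = set0) ?measure0 //.
  apply/seteqP; split=> // x nV.
  pose r : R := n.+1%:R^-1 / 2.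
  have r0 : 0 < r by rewrite divr_gt0 // invr_gt0 ltr0n.
  have [i [Uix sub]] := Ub (@open_interior _ (ball (phi x) r))
     (nbhsx_ballx (phi x) r r0).
  apply: (nV i.+1) => //; exists i; split=> //; last exact: subset_closure.
  exists (phi x); apply: subset_trans (@interior_subset _ _).
  by apply: subset_trans sub; exact: subset_closure.
exists (\bigcap_n V n (m n)); last first.
  rewrite preimage_bigcap setC_bigcap.
  by apply: mu_bigcup_small => // n; exact: mV.
have cC : closed (\bigcap_n V n (m n)) by apply: closed_bigI => n _; exact: cV.
rewrite compact_ultra => F FU FC.
have FF : ProperFilter F := @ultra_proper _ _ FU.
have Fcau : cauchy F.
  apply/cauchy_exP => r r0.
  have [n nr] : exists n, n.+1%:R^-1 < r.
    by have [n _ /(_ n (leqnn n)) nr] := near_infty_natSinv_lt (PosNum r0); exists n.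
  have FV : F (V n (m n)) by apply: filterS FC => x; exact.
  have [i [[c si] Fi]] : exists i, small n i /\ F (closure (U i)).
    elim: (m n) FV => [|k IH] Fk.
      by have [x [i []]] := filter_ex Fk.
    have [/IH //|nF] := in_ultra_setVsetC (V n k) FU.
    have [x [[i [ik si xi]] nx]] := filter_ex (filterI Fk nF).
    have ik' : i = k.
      apply/eqP; rewrite eqn_leq -ltnS ik /= leqNgt; apply/negP => ik'.
      by apply: nx; exists i.
    exists i; split=> //.
    apply: filterS (filterI Fk nF) => y [[j [jk sj yj]] ny].
    suff -> : i = j by [].
    have [jk'|kj] := ltnP j k; last by lia.
    by case: ny; exists j.
  exists c; apply: filterS Fi; apply: subset_trans (closure_subset si) _.
  apply: subset_trans (@subset_closure_half _ _ _ _ _) _; first by rewrite invr_gt0 ltr0n.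
  by apply: le_ball; exact: ltW.
have Fl := cauchy_cvg F Fcau.
exists (lim F); split; last exact: Fl.
apply: cC => B /Fl FB.
exact: filter_ex (filterI FC FB).
Qed.

(** The sets that are, like their complements, approximated from inside by
    compact sets form a sigma-algebra.  It contains the closed sets because [mu]
    is tight, and an open set is a countable union of closed sets. *)
Lemma standard_class : compact_class [set A | exists C, compact C /\ A = phi @^-1` C].
Proof.
have cc (C : set P) : compact C -> closed C by move=> cC; exact: compact_closed.
have KI : forall A : nat -> set X,
    (forall n, exists C, compact C /\ A n = phi @^-1` C) ->
    exists C, compact C /\ (\bigcap_n A n) = phi @^-1` C.
  move=> A /choice[C hC]; have cC n : compact (C n) by case: (hC n).
  exists (\bigcap_n C n); split; last first.
    by rewrite preimage_bigcap; apply: eq_bigcapr => n _; case: (hC n).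
  apply: (subclosed_compact _ (cC 0%N)); last by move=> x; exact.
  by apply: closed_bigI => n _; apply: cc.
split.
- by move=> _ [C [hC ->]]; apply: preimage_closed; exact: cc.
- move=> _ _ [C [hC ->]] [D [hD ->]]; exists (C `|` D); rewrite preimage_setU; split=> //.
  exact: compactU.
- exact: KI.
- move=> A hA dA neA; have /choice[C hC] := hA.
  have cC n : compact (C n) by case: (hC n).
  have AC n : A n = phi @^-1` (C n) by case: (hC n).
  have imA n : phi @` A n = C n by rewrite AC image_preimage_phi.
  have dAm n k : A (k + n)%N `<=` A n by elim: k => [//|k IH]; exact: subset_trans (dA _) IH.
  have FP : ProperFilter (filter_from [set: nat] C).
    apply: filter_from_proper; last first.
      by move=> n _; have [x Ax] := neA n; exists (phi x); rewrite -imA; exists x.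
    apply: filter_from_filter; first by exists 0%N.
    move=> i j _ _; exists (i + j)%N => // y.
    rewrite -!imA => -[x Ax <-]; split; exists x => //.
      by apply: (dAm i j); rewrite addnC.
    exact: (dAm j i).
  have [p [_ clp]] := cC 0%N _ FP (ex_intro2 _ _ 0%N I (fun x => id)).
  have [x xp] : exists x, phi x = p by case: phib => psi pk kp; exists (psi p).
  exists x => n _; rewrite AC /preimage /mkset xp.
  apply: (cc _ (cC n)) => B nB; apply: clp => //; by exists n.
have tightK A : measurable A -> forall e : R, 0 < e -> forall D, closed D ->
    A = phi @^-1` D -> exists C, [/\ (exists C', compact C' /\ C = phi @^-1` C'),
    C `<=` A & (mu (A `\` C) <= e%:E)%E].
  move=> mA e e0 D cD AD; have [C cC hC] := tight e0.
  have cDC : compact (C `&` D) by exact: compact_closedI.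
  exists (phi @^-1` (C `&` D)); split; first by exists (C `&` D).
    by rewrite AD => x [].
  apply: le_trans hC; apply: le_measure; rewrite ?inE.
  - by apply: measurableD => //; apply: preimage_closed; exact: cc.
  - by apply: measurableC; apply: preimage_closed; exact: cc.
  - by rewrite AD => x [Dx nx] Cx; apply: nx.
pose K := [set A | exists C, compact C /\ A = phi @^-1` C].
have KU A B : K A -> K B -> K (A `|` B).
  move=> [C [hC ->]] [D [hD ->]]; exists (C `|` D); rewrite preimage_setU; split=> //.
  exact: compactU.
have Km A : K A -> measurable A.
  by move=> [C [hC ->]]; apply: preimage_closed; exact: cc.
pose reg (A : set X) := measurable A /\ forall e : R, 0 < e ->
  exists C, [/\ K C, C `<=` A & (mu (A `\` C) <= e%:E)%E].
suff : measurable `<=` [set A | reg A /\ reg (~` A)].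
  by move=> h A mA; case: (h _ mA) => -[].
have regU (A : nat -> set X) : (forall n, reg (A n)) -> reg (\bigcup_n A n).
  move=> hA; have mA n : measurable (A n) by case: (hA n).
  split=> [|e e0]; first exact: bigcupT_measurable.
  have e20 : 0 < e / 2 by rewrite divr_gt0.
  have /choice[C hC] : forall n, exists C, [/\ K C, C `<=` A n
      & (mu (A n `\` C) <= (e / 2 / (2 ^ n.+1)%:R)%:E)%E].
    by move=> n; apply: (hA n).2; exact: half_pow_gt0.
  have kC n : K (C n) by case: (hC n).
  pose D m := [set x | exists2 i, (i <= m)%N & C i x].
  have kD m : K (D m).
    elim: m => [|m IH].
      rewrite (_ : D 0%N = C 0%N) //; apply/seteqP; split=> x.
        by move=> [i]; rewrite leqn0 => /eqP ->.
      by exists 0%N.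
    rewrite (_ : D m.+1 = D m `|` C m.+1); first exact: KU.
    apply/seteqP; split=> x.
      by move=> [i]; rewrite leq_eqVlt => /predU1P[->|im ?]; [right|left; exists i].
    by move=> [[i im ?]|?]; [exists i => //; rewrite ltnW|exists m.+1].
  pose W m := \bigcup_n C n `\` D m.
  have mUC : measurable (\bigcup_n C n) by apply: bigcupT_measurable => n; exact: Km.
  have mW m : measurable (W m) by apply: measurableD => //; exact: Km.
  have [m hm] : exists m, (mu (W m) <= (e / 2)%:E)%E.
    apply: mu_decreasing_small => //.
      by move=> n x [? nD]; split=> // -[i im Ci]; apply: nD; exists i => //; rewrite ltnW.
    rewrite (_ : \bigcap_n _ = set0) ?measure0 //; apply/seteqP; split=> // x h.
    have [[i _ Ci] _] := h 0%N I; have [_ []] := h i I; by exists i.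
  exists (D m); split=> //.
    by move=> x [i _ Ci]; exists i => //; case: (hC i) => _ + _; exact.
  have mAC : measurable (\bigcup_n (A n `\` C n)).
    by apply: bigcupT_measurable => n; apply: measurableD => //; exact: Km.
  apply: (@le_trans _ _ (mu (\bigcup_n (A n `\` C n) `|` W m))).
    apply: le_measure; rewrite ?inE.
    - by apply: measurableD; [exact: bigcupT_measurable|exact: Km].
    - exact: measurableU.
    - move=> x [[n _ An] nD]; have [Cn|nCn] := pselect (C n x).
        by right; split=> //; exists n.
      by left; exists n.
  apply: le_trans (measureU2 _ _ _) _ => //.
  rewrite [e in leRHS]splitr EFinD; apply: leeD => //.
  apply: mu_bigcup_small => //; first by move=> n; apply: measurableD => //; exact: Km.
  by move=> n; case: (hC n).
have regI (A : nat -> set X) : (forall n, reg (A n)) -> reg (\bigcap_n A n).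
  move=> hA; have mA n : measurable (A n) by case: (hA n).
  split=> [|e e0]; first exact: bigcapT_measurable.
  have /choice[C hC] : forall n, exists C, [/\ K C, C `<=` A n
      & (mu (A n `\` C) <= (e / (2 ^ n.+1)%:R)%:E)%E].
    by move=> n; apply: (hA n).2; exact: half_pow_gt0.
  have kC n : K (C n) by case: (hC n).
  exists (\bigcap_n C n); split; first exact: KI.
    by move=> x Cx n _; case: (hC n) => _ + _; apply; exact: Cx.
  have mAC : measurable (\bigcup_n (A n `\` C n)).
    by apply: bigcupT_measurable => n; apply: measurableD => //; exact: Km.
  apply: (@le_trans _ _ (mu (\bigcup_n (A n `\` C n)))).
    apply: le_measure; rewrite ?inE //.
    - apply: measurableD; first exact: bigcapT_measurable.
      by apply: bigcapT_measurable => n; exact: Km.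
    - move=> x [Ax nC]; apply: contrapT => h; apply: nC => n _.
      by apply: contrapT => nCn; apply: h; exists n => //; split=> //; exact: Ax.
  apply: mu_bigcup_small => //; first by move=> n; apply: measurableD => //; exact: Km.
  by move=> n; case: (hC n).
have regC (D : set P) : closed D -> reg (phi @^-1` D).
  move=> cD; have mD := preimage_closed cD; split=> // e e0; exact: (tightK _ mD e e0 D).
apply: open_ind.
- split; first by rewrite -(preimage_set0 phi); apply: regC; exact: closed0.
  by rewrite setC0 -(preimage_setT phi); apply: regC; exact: closedT.
- by move=> A [? ?]; rewrite /mkset setCK.
- move=> A hA; split; first by apply: regU => n; case: (hA n).
  by rewrite setC_bigcup; apply: regI => n; case: (hA n).
- move=> O oO; split; last first.
    by rewrite preimage_setC; apply: regC; exact: open_closedC.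
  pose F n := if `[<closure (U n) `<=` O>] then closure (U n) else set0.
  have -> : phi @^-1` O = \bigcup_n (phi @^-1` (F n)).
    apply/seteqP; split=> x.
      move=> Ox; have [n [Un sn]] := Ub oO Ox; exists n => //.
      by rewrite /F asboolT //=; exact: subset_closure.
    move=> [n _]; rewrite /F /preimage /mkset.
    by case: asboolP => [h /h|_].
  apply: regU => n; apply: regC; rewrite /F; case: ifP => _.
    exact: closed_closure.
  exact: closed0.
Qed.

End Standard.

Definition separating (V : nat -> set X) :=
  forall x y, (forall n, V n x <-> V n y) -> x = y.

Definition generating (V : nat -> set X) :=
  forall G : set (set X), G set0 -> (forall A, G A -> G (~` A)) ->
  (forall A : nat -> set X, (forall n, G (A n)) -> G (\bigcup_n A n)) ->
  (forall n, G (V n)) -> measurable `<=` G.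

Theorem standard_borel_classes : standard_borel R X ->
  exists K V, [/\ compact_class K, (forall n, measurable (V n)),
    separating V & generating V].
Proof.
case=> P [phi [hP [B cB [Bo Bb]] phib phim]].
have nbr (O : set P) x : open O -> O x -> exists U, [/\ B U, U x & U `<=` O].
  move=> oO Ox; have [U [BU Ux] UO] := Bb x O (open_nbhs_nbhs (conj oO Ox)).
  by exists U.
have [U [Uo Ub]] : exists U : nat -> set P, (forall n, open (U n)) /\
    forall O x, open O -> O x -> exists n, U n x /\ U n `<=` O.
  case/pfcard_geP: cB => [B0|[u]].
    have [U [+ _ _]] := nbr setT point openT I.
    by rewrite B0.
  exists u; split=> [n|O x oO Ox]; first by apply: Bo; exact: funS.
  have [W [BW Wx WO]] := nbr O x oO Ox.
  have [n _ e] : (u @` setT) W by rewrite image_eq.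
  by exists n; rewrite e.
have Uc O x : open O -> O x -> exists n, U n x /\ closure (U n) `<=` O.
  move=> oO Ox.
  have [W nW WO] := @uniform_regular P x O (open_nbhs_nbhs (conj oO Ox)).
  have [n [Ux UW]] := Ub _ _ (@open_interior _ W) nW.
  exists n; split=> //; apply: subset_trans WO; apply: closure_subset.
  by apply: subset_trans UW _; exact: interior_subset.
exists [set A | exists C, compact C /\ A = phi @^-1` C], (fun n => phi @^-1` (U n)).
split.
- exact: (standard_class hP phib phim Uc).
- by move=> n; apply: (preimage_open phib phim).
- move=> x y h; apply: (bij_inj phib); apply: contrapT => /eqP ne.
  move: hP; rewrite open_hausdorff => /(_ _ _ ne).
  case=> -[D1 D2] /= [x1 y2] [p1 p2 e12].
  have [n [Unx UO]] := Ub D1 (phi x) p1 (set_mem x1).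
  suff : set0 (phi y) by [].
  rewrite -(eqP e12); split; last exact: set_mem.
  by apply: UO; apply/(h n).
- move=> G G0 GC GU GV; apply: (open_ind phib phim) => // O oO.
  pose F n := if `[<U n `<=` O>] then U n else set0.
  have -> : phi @^-1` O = \bigcup_n (phi @^-1` (F n)).
    apply/seteqP; split=> x.
      by move=> Ox; have [n [Un sn]] := Ub _ _ oO Ox; exists n => //; rewrite /F asboolT.
    move=> [n _]; rewrite /F /preimage /mkset.
    by case: asboolP => [h /h|_].
  apply: GU => n; rewrite /F; case: ifP => _; [exact: GV|by rewrite preimage_set0].
Qed.
End MeasureTools.

(** * Images and sections on well split sets *)

Section Selection.
Context (R : realType) (d : measure_display) (X : measurableType d).
Variable mu : probability X R.
Variables (K : set (set X)) (V : nat -> set X).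
Hypotheses (Kc : compact_class mu K) (Vm : forall n, measurable (V n)).
Hypothesis Vsep : separating V.

(** Equality of the first [n] digits in the coding of points by the sets [V i]. *)
Definition agree n (x y : X) := forall i, (i < n)%N -> (V i x <-> V i y).

Lemma agree_sym n x y : agree n x y -> agree n y x.
Proof. by move=> h i /h h'; split=> /h'. Qed.
Lemma agree_trans n y x z : agree n x y -> agree n y z -> agree n x z.
Proof. by move=> h h' i ni; rewrite (h i ni) (h' i ni). Qed.
Lemma agree_lt n m x y : (n <= m)%N -> agree m x y -> agree n x y.
Proof. by move=> nm h i ni; apply: h; exact: leq_trans nm. Qed.
Lemma agreeS n x y : agree n x y -> (V n x <-> V n y) -> agree n.+1 x y.
Proof.
by move=> h h' i; rewrite ltnS leq_eqVlt => /predU1P[->|/h].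
Qed.

Lemma agree_measurable n (A : set X) :
  (forall x y, agree n x y -> A x -> A y) -> measurable A.
Proof.
elim: n A => [|n IH] A hA.
  have [[x Ax]|nA] := pselect (exists x, A x).
    rewrite (_ : A = setT); first exact: measurableT.
    by apply/seteqP; split=> // y _; apply: hA Ax => i.
  by rewrite (_ : A = set0) //; apply/seteqP; split=> // x Ax; apply: nA; exists x.
pose B (b : Prop) := [set y | exists x, [/\ A x, V n x <-> b & agree n x y]].
have mB b : measurable (B b).
  apply: IH => x y xy [z [Az bz zx]]; exists z; split=> //; exact: agree_trans xy.
rewrite (_ : A = (B True `&` V n) `|` (B False `&` ~` V n)).
  apply: measurableU; apply: measurableI => //; exact: measurableC.
apply/seteqP; split=> [x Ax|x].
  by have [Vx|nVx] := pselect (V n x); [left|right]; split=> //; exists x; split.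
by case=> -[[y [Ay ey yx]] Vx]; apply: hA Ay; apply: agreeS => //; rewrite ey; split.
Qed.

Definition splits (Q : nat -> set X) (C : set X) :=
  forall n, K (C `&` Q n) /\ K (C `\` Q n).

Lemma Kmeas C : K C -> measurable C. Proof. by case: Kc => h _ _ _ _ /h. Qed.

Lemma KI2 A B : K A -> K B -> K (A `&` B).
Proof.
move=> KA KB; have -> : A `&` B = \bigcap_n (if n is 0%N then A else B).
  apply/seteqP; split=> [x [Ax Bx] [|n] _ //|x h]; split; [exact: (h 0%N)|exact: (h 1%N)].
by case: Kc => _ _ h _ _; apply: h => -[|n].
Qed.

(** This is the set provided by the theorem of Lusin: each [Q n] is clopen in
    [C], as far as [K] can tell. *)
Lemma splitting_subset (Q : nat -> set X) (Z : set X) (e : R) :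
  (forall n, measurable (Q n)) -> measurable Z -> 0 < e ->
  exists C, [/\ K C, C `<=` Z, (mu (Z `\` C) <= e%:E)%E & splits Q C].
Proof.
move=> Qm Zm e0; case: Kc => KM KU KI _ inn.
have e2 : 0 < e / 2 by rewrite divr_gt0.
have [C0 [KC0 C0Z hC0]] := inn _ Zm _ e2.
have he n : 0 < e / 2 / (2 ^ n.+1)%:R / 2 by rewrite divr_gt0 // half_pow_gt0.
have /choice[A hA] : forall n, exists C, [/\ K C, C `<=` Q n
    & (mu (Q n `\` C) <= (e / 2 / (2 ^ n.+1)%:R / 2)%:E)%E].
  by move=> n; exact: inn.
have /choice[B hB] : forall n, exists C, [/\ K C, C `<=` ~` Q n
    & (mu ((~` Q n) `\` C) <= (e / 2 / (2 ^ n.+1)%:R / 2)%:E)%E].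
  by move=> n; apply: inn => //; exact: measurableC.
have KA n : K (A n) by case: (hA n).
have KB n : K (B n) by case: (hB n).
have KC : K (C0 `&` \bigcap_n (A n `|` B n)).
  by apply: KI2 => //; apply: KI => n; exact: KU.
pose W n := (Q n `\` A n) `|` (~` Q n `\` B n).
have mW1 n : measurable (Q n `\` A n) by apply: measurableD => //; exact: KM.
have mW2 n : measurable (~` Q n `\` B n).
  by apply: measurableD; [exact: measurableC|exact: KM].
have mW n : measurable (W n) by exact: measurableU.
have mZC : measurable (Z `\` C0) by apply: measurableD => //; exact: KM.
exists (C0 `&` \bigcap_n (A n `|` B n)); split=> //.
- by move=> x [/C0Z].
- apply: (@le_trans _ _ (mu ((Z `\` C0) `|` \bigcup_n W n))).
    apply: le_measure; rewrite ?inE.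
    + by apply: measurableD => //; exact: KM.
    + by apply: measurableU => //; exact: bigcupT_measurable.
    + move=> x [Zx nC]; have [C0x|nC0] := pselect (C0 x); last by left.
      right; apply: contrapT => h; apply: nC; split=> // n _.
      apply: contrapT => /not_orP[nA nB]; apply: h; exists n => //.
      by have [Qx|nQ] := pselect (Q n x); [left|right].
  apply: le_trans (measureU2 _ _ _) _ => //; first exact: bigcupT_measurable.
  rewrite [e in leRHS]splitr EFinD; apply: leeD => //.
  apply: mu_bigcup_small => // n.
  apply: le_trans (measureU2 _ _ _) _ => //.
  rewrite [leRHS](_ : _ = (e / 2 / (2 ^ n.+1)%:R / 2)%:E + (e / 2 / (2 ^ n.+1)%:R / 2)%:E)%E.
    by apply: leeD; [case: (hA n)|case: (hB n)].
  by rewrite -EFinD -splitr.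
- move=> n; split.
    rewrite (_ : _ `&` _ = (C0 `&` \bigcap_n (A n `|` B n)) `&` A n); first exact: KI2.
    apply/seteqP; split=> x [[C0x h] Qx]; split=> //; last by case: (hA n) => _ + _; exact.
    by have [//|Bx] := h n I; case: (hB n) => _ /(_ _ Bx).
  rewrite (_ : _ `\` _ = (C0 `&` \bigcap_n (A n `|` B n)) `&` B n); first exact: KI2.
  apply/seteqP; split=> x [[C0x h] Qx]; split=> //.
    by have [Ax|//] := h n I; case: (hA n) => _ /(_ _ Ax).
  by case: (hB n) => _ h' _; apply: h'.
Qed.

Variable f : X -> X.
Hypothesis fm : measurable_fun setT f.

(** The analogue of a compact set on which [f] is continuous. *)
Definition well_split C :=
  [/\ K C, splits V C & splits (fun n => f @^-1` (V n)) C].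

Lemma well_split_subset Z (e : R) : measurable Z -> 0 < e ->
  exists C, [/\ well_split C, C `<=` Z & (mu (Z `\` C) <= e%:E)%E].
Proof.
move=> mZ e0.
(* The families [V] and [f @^-1` V] are split together: the first one at the
   odd indices, the second one at the even indices. *)
pose Q n := if odd n then V n./2 else f @^-1` (V n./2).
have [|C [KC CZ hC sC]] := @splitting_subset Q Z e _ mZ e0.
  by move=> n; rewrite /Q; case: ifP => _ //; exact: (measurable_preimage fm).
exists C; split=> //; split=> // n.
  by have := sC n.*2.+1; rewrite /Q /= odd_double /= uphalf_double.
by have := sC n.*2; rewrite /Q odd_double doubleK.
Qed.

Lemma well_split_sub C D : well_split C -> D `<=` C -> K D -> well_split D.
Proof.
case=> KC h1 h2 DC KD.
have aux (Q : nat -> set X) : splits Q C -> splits Q D.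
  move=> h n; have [hI hD] := h n; split.
    rewrite (_ : _ `&` _ = D `&` (C `&` Q n)); first exact: KI2.
    by apply/seteqP; split=> x [Dx]; [move=> Qx; split=> //; split=> //; exact: DC|case].
  rewrite (_ : _ `\` _ = D `&` (C `\` Q n)); first exact: KI2.
  by apply/seteqP; split=> x [Dx]; [move=> Qx; split=> //; split=> //; exact: DC|case].
by split=> //; exact: aux.
Qed.

Lemma well_splitI C n : well_split C -> well_split (C `&` V n).
Proof. by move=> wC; apply: (well_split_sub wC); [exact: subIsetl|case: wC => _ /(_ n)[]]. Qed.

Lemma well_splitD C n : well_split C -> well_split (C `\` V n).
Proof. by move=> wC; apply: (well_split_sub wC); [exact: subDsetl|case: wC => _ /(_ n)[]]. Qed.

Lemma well_split_fibre C y : well_split C -> K (C `&` f @^-1` [set y]).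
Proof.
move=> [KC _ h].
pose F n := if `[<V n y>] then C `&` f @^-1` (V n) else C `\` f @^-1` (V n).
have -> : C `&` f @^-1` [set y] = \bigcap_n F n.
  apply/seteqP; split=> [x [Cx fx] n _|x hx].
    by rewrite /F; case: asboolP => Vy; split; rewrite //= fx.
  split; first by have := hx 0%N I; rewrite /F; case: ifP => _ [].
  apply: Vsep => n; have := hx n I; rewrite /F.
  by case: asboolP => ? [_ /=].
by case: Kc => _ _ KI _ _; apply: KI => n; rewrite /F; case: ifP => _; case: (h n).
Qed.

(** A point [y] is in the image of [C] as soon as every finite part of its code is
    the code of an image: the points of [C] that fit up to [n] form a decreasing
    sequence of nonempty members of [K]. *)
Lemma well_split_image C : well_split C -> measurable (f @` C).
Proof.
move=> [KC _ h].
pose I n := [set y | exists2 x, C x & agree n (f x) y].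
have -> : f @` C = \bigcap_n I n.
  apply/seteqP; split=> [_ [x Cx <-] n _|y hy]; first by exists x.
  pose A n := [set x | C x /\ agree n (f x) y].
  have KA n : K (A n).
    elim: n => [|n IH].
      by rewrite (_ : A 0%N = C) //; apply/seteqP; split=> [x []//|x Cx]; split.
    have [Vy|nVy] := pselect (V n y).
      rewrite (_ : A n.+1 = A n `&` (C `&` f @^-1` (V n))).
        by apply: KI2 => //; case: (h n).
      apply/seteqP; split=> x.
        by move=> [Cx ag]; split; split=> //; [exact: agree_lt ag|apply/(ag n)].
      by move=> [[Cx ag] [_ Vx]]; split=> //; apply: agreeS.
    rewrite (_ : A n.+1 = A n `&` (C `\` f @^-1` (V n))).
      by apply: KI2 => //; case: (h n).
    apply/seteqP; split=> x.
      move=> [Cx ag]; split; split=> //; first exact: agree_lt ag.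
      by move=> Vx; apply: nVy; apply/(ag n).
    by move=> [[Cx ag] [_ Vx]]; split=> //; apply: agreeS.
  have [x hx] : (\bigcap_n A n) !=set0.
    case: Kc => _ _ _ FIP _; apply: FIP => // n.
      by move=> x [Cx ag]; split=> //; exact: agree_lt ag.
    by have [x Cx ag] := hy n Logic.I; exists x.
  exists x; first by case: (hx 0%N Logic.I).
  by apply: Vsep => n; case: (hx n.+1 Logic.I) => _; apply.
apply: bigcapT_measurable => n; apply: (@agree_measurable n) => x y xy [z Cz zx].
by exists z => //; exact: agree_trans xy.
Qed.

Lemma well_split_fibre_agree C n : well_split C ->
  measurable [set x | exists z, [/\ C z, f z = f x & agree n z x]].
Proof.
elim: n C => [|n IH] C wC.
  rewrite (_ : mkset _ = f @^-1` (f @` C)).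
    by apply: (measurable_preimage fm); exact: well_split_image.
  apply/seteqP; split=> x; first by move=> [z [Cz e _]]; exists z.
  by move=> [z Cz e]; exists z; split.
rewrite (_ : mkset _ =
   ([set x | exists z, [/\ (C `&` V n) z, f z = f x & agree n z x]] `&` V n) `|`
   ([set x | exists z, [/\ (C `\` V n) z, f z = f x & agree n z x]] `\` V n)).
  apply: measurableU; first by apply: measurableI => //; apply: IH; exact: well_splitI.
  by apply: measurableD => //; apply: IH; exact: well_splitD.
apply/seteqP; split=> x.
  move=> [z [Cz e ag]]; have ag' : agree n z x by exact: agree_lt ag.
  have [Vx|nVx] := pselect (V n x); [left|right]; split=> //; exists z; split=> //; split=> //.
    exact/(ag n).
  by move=> Vz; apply: nVx; apply/(ag n).
case=> -[[z [[Cz Vz] e ag]] Vx]; exists z; split=> //; exact: agreeS.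
Qed.

(** Choose in each fibre the point with the lexicographically greatest code; the
    fibres are in [K], so that there is one. *)
Lemma selection C : well_split C -> exists S, [/\ measurable S, S `<=` C,
  f @` C `<=` f @` S & {in S &, injective f}].
Proof.
move=> wC; have KC : K C by case: wC.
pose W n := [set x | exists z, [/\ (C `&` V n) z, f z = f x & agree n z x]] `\` V n.
have mW n : measurable (W n).
  by apply: measurableD => //; apply: well_split_fibre_agree; exact: well_splitI.
exists (C `\` \bigcup_n W n); split.
- by apply: measurableD; [exact: Kmeas|exact: bigcupT_measurable].
- exact: subDsetl.
- move=> _ [x0 Cx0 <-].
  (* [M n] consists of the points of the fibre whose code agrees with the greatest
     one in the first [n] digits. *)
  pose M := fix M n := if n is k.+1 then
     if `[<M k `&` V k !=set0>] then M k `&` V k else M k else C `&` f @^-1` [set f x0].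
  have sV : splits V C by case: wC.
  have MC n : M n `<=` C.
    elim: n => [|n IH]; first exact: subIsetl.
    by rewrite /=; case: ifP => _ //; apply: subset_trans IH; exact: subIsetl.
  have KM n : K (M n).
    elim: n => [|n IH] /=; first exact: well_split_fibre.
    case: ifP => _ //; rewrite (_ : _ `&` _ = M n `&` (C `&` V n)).
      by apply: KI2 => //; case: (sV n).
    by apply/seteqP; split=> x [Mx]; [move=> Vx; split=> //; split=> //; exact: MC Mx|case].
  have [x hx] : (\bigcap_n M n) !=set0.
    case: Kc => _ _ _ FIP _; apply: FIP => // n.
      by rewrite /=; case: ifP => _ //; exact: subIsetl.
    by elim: n => [|n IH] /=; [exists x0|case: asboolP].
  have [Cx fx] := hx 0%N I.
  exists x => //; split=> // -[n _ [[z [[Cz Vz] fz ag]] nVx]].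
  have Mz k : (k <= n)%N -> M k z.
    elim: k => [_|k IH kn] /=; first by split=> //=; rewrite fz fx.
    have := hx k.+1 I; rewrite /=; case: asboolP => [_ [_ Vx]|_ _]; last first.
      by apply: IH; exact: ltnW.
    by split; [apply: IH; exact: ltnW|apply/(ag k)].
  have := hx n.+1 I; rewrite /=; case: asboolP => [_ []//|h _].
  by apply: h; exists z; split=> //; exact: Mz.
- move=> x z; rewrite !inE => -[Cx nx] [Cz nz] e; apply: Vsep => n.
  suff : agree n.+1 x z by apply.
  elim: n.+1 => [|k IH]; first by move=> i.
  apply: agreeS => //; split=> [Vx|Vz]; apply: contrapT => nV.
    by apply: nz; exists k => //; split=> //; exists x; split.
  by apply: nx; exists k => //; split=> //; exists z; split=> //; exact: agree_sym.
Qed.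

End Selection.

(** * Sections almost everywhere *)

Section MaximalSet.
Context (R : realType) (d : measure_display) (X : measurableType d).
Variable mu : probability X R.

(** The union of a sequence whose measures tend to the supremum over [F] is still
    in [F]. *)
Lemma maximal_measure (F : set (set X)) : F `<=` measurable -> F set0 ->
  (forall A : nat -> set X, (forall n, F (A n)) -> F (\bigcup_n A n)) ->
  exists2 S, F S & forall A, F A -> mu (A `\` S) = 0%E.
Proof.
move=> Fm F0 FU; pose s := ereal_sup [set mu A | A in F].
have s1 : (s <= 1)%E by apply: ge_ereal_sup => _ [A FA <-]; apply: probability_le1; exact: Fm.
have s0 : (0 <= s)%E by apply: ereal_sup_ubound; exists set0 => //; rewrite measure0.
have sfin : s \is a fin_num by rewrite ge0_fin_numE //; apply: le_lt_trans s1 (ltry _).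
have /choice[S hS] : forall n, exists A, F A /\ (s - (n.+1%:R^-1)%:E < mu A)%E.
  move=> n; have e0 : 0 < (n.+1%:R^-1 : R) by rewrite invr_gt0 ltr0n.
  by have [_ [A FA <-] h] := ub_ereal_sup_adherent e0 sfin; exists A.
have FS : F (\bigcup_n S n) by apply: FU => n; case: (hS n).
exists (\bigcup_n S n) => // A FA.
have mS := Fm _ FS; have mA := Fm _ FA.
have FAS : F (A `|` \bigcup_n S n).
  rewrite (_ : _ `|` _ = \bigcup_n (if n is k.+1 then S k else A)).
    by apply: FU => -[|n] //; case: (hS n).
  apply/seteqP; split=> x; first by move=> [Ax|[n _ Sx]]; [exists 0%N|exists n.+1].
  by move=> [[|n] _ h]; [left|right; exists n].
have mD : measurable (A `\` \bigcup_n S n) by exact: measurableD.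
have le : (mu (A `\` \bigcup_n S n) + mu (\bigcup_n S n) <= s)%E.
  apply: ereal_sup_ubound; exists (A `|` \bigcup_n S n) => //.
  rewrite -measureU //; last by apply/seteqP; split=> // x [[]].
  congr (mu _); apply/seteqP; split=> x.
    by move=> [Ax|Sx]; [have [Sx|nSx] := pselect ((\bigcup_n S n) x); [right|left]|right].
  by move=> [[Ax _]|Sx]; [left|right].
have ge : (s <= mu (\bigcup_n S n))%E.
  apply/lee_addgt0Pr => e e0.
  have [n hn] : exists n, n.+1%:R^-1 < e.
    by have [n _ /(_ n (leqnn n)) nr] := near_infty_natSinv_lt (PosNum e0); exists n.
  have [FSn /ltW hSn] := hS n.
  rewrite leeBlDr // in hSn.
  apply: le_trans hSn _; apply: leeD; last by rewrite lee_fin ltW.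
  by apply: le_measure; rewrite ?inE //; [exact: Fm|exact: bigcup_sup].
have fS : mu (\bigcup_n S n) \is a fin_num.
  by rewrite ge0_fin_numE // probability_fin.
apply/eqP; rewrite eq_le measure_ge0 andbT -(leeD2rE _ _ fS) add0e.
exact: le_trans le ge.
Qed.

End MaximalSet.

Section MeasurableSections.
Context (R : realType) (d : measure_display) (X : measurableType d).
Variable mu : probability X R.
Variable f : X -> X.
Hypothesis fm : measurable_fun setT f.
Hypothesis hmcp : mcp mu (E_of f).
Local Notation E := (E_of f).

Lemma invariant_null N : mu.-negligible N -> exists N',
  [/\ measurable N', mu N' = 0%E, invariant_set E N' & N `<=` N'].
Proof.
move=> nN.
have /choice[g hg] : forall A, exists B, mu.-negligible A ->
    [/\ measurable B, mu B = 0%E & saturation E A `<=` B].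
  move=> A; have [nA|] := pselect (mu.-negligible A); last by exists A.
  by have [B [? ? ?]] := hmcp nA; exists B.
have nk k : mu.-negligible (iter k g N).
  by elim: k => // k /hg[mB B0 _]; apply/negligibleP.
have step k : saturation E (iter k g N) `<=` iter k.+1 g N by case: (hg _ (nk k)).
exists (\bigcup_k (iter k.+1 g N)).
have mk k : measurable (iter k.+1 g N) by case: (hg _ (nk k)).
split.
- by apply: bigcupT_measurable.
- apply/negligibleP; first exact: bigcupT_measurable.
  by apply: negligible_bigcup.
- move=> x y xy [k _ kx]; exists k.+1 => //; apply: step; by exists x.
- by move=> x Nx; exists 0%N => //; apply: step; exists x => //; exact: E_refl.
Qed.

Lemma ae_invariant (P : X -> Prop) : (\forall x \ae mu, P x) -> exists N,
  [/\ measurable N, mu N = 0%E, invariant_set E N & forall x, ~ N x -> P x].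
Proof.
move=> /invariant_null[N [mN N0 iN PN]]; exists N; split=> // x nNx.
by apply: contrapT => nP; apply: nNx; exact: PN.
Qed.

Lemma invariant_setC (A : set X) : invariant_set E A -> invariant_set E (~` A).
Proof. by move=> h x y xy nA Ay; apply: nA; apply: h Ay; exact: E_sym. Qed.

Lemma ae_class (P : X -> Prop) : (\forall x \ae mu, P x) ->
  \forall x \ae mu, forall y, E (x, y) -> P y.
Proof.
move=> /ae_invariant[N [mN N0 iN h]]; exists N; split=> //.
move=> x /= nP; apply: contrapT => nN; apply: nP => y xy; apply: h.
exact: (invariant_setC iN xy).
Qed.

Variables (K : set (set X)) (V : nat -> set X).
Hypotheses (Kc : compact_class mu K) (Vm : forall n, measurable (V n)).
Hypotheses (Vsep : separating V) (Vgen : generating V).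

(** Approximate [B] from inside by well split sets; the image of the remainder is
    in the saturation of a null set. *)
Lemma image_measurable_ae B : measurable B ->
  exists I, [/\ measurable I, I `<=` f @` B & mu.-negligible (f @` B `\` I)].
Proof.
move=> mB.
have /choice[C hC] : forall n, exists C, [/\ well_split K V f C, C `<=` B
    & (mu (B `\` C) <= (n.+1%:R^-1)%:E)%E].
  by move=> n; apply: (well_split_subset Kc Vm fm mB); rewrite invr_gt0 ltr0n.
have mC n : measurable (C n) by case: (hC n) => -[? _ _] _ _; exact: (Kmeas Kc).
exists (\bigcup_n (f @` C n)); split.
- by apply: bigcupT_measurable => n; apply: (well_split_image Kc Vm Vsep); case: (hC n).
- by move=> _ [n _ [x Cx <-]]; exists x => //; case: (hC n) => _ + _; exact.
- have mD : measurable (B `\` \bigcup_n C n).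
    by apply: measurableD => //; exact: bigcupT_measurable.
  have /hmcp : mu.-negligible (B `\` \bigcup_n C n).
    apply/negligibleP => //; apply/eqP; rewrite eq_le measure_ge0 andbT.
    apply/lee_addgt0Pr => e e0; rewrite add0e.
    have [n hn] : exists n, n.+1%:R^-1 < e.
      by have [n _ /(_ n (leqnn n)) nr] := near_infty_natSinv_lt (PosNum e0); exists n.
    apply: (@le_trans _ _ (n.+1%:R^-1)%:E); last by rewrite lee_fin ltW.
    case: (hC n) => _ _; apply: le_trans; apply: le_measure; rewrite ?inE //.
      exact: measurableD.
    by apply: setDS; exact: bigcup_sup.
  apply: negligibleS => _ [[x Bx <-] nI]; exists x; last exact: E_f.
  by split=> // -[n _ Cx]; apply: nI; exists n => //; exists x.
Qed.

(** A selection from a well split set [C] has the image of [C], so that its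
    saturation contains [C]; were it null, so would be [C]. *)
Lemma injective_subset Z : measurable Z -> mu Z <> 0%E -> exists S,
  [/\ measurable S, S `<=` Z, {in S &, injective f} & mu S <> 0%E].
Proof.
move=> mZ Z0.
have fZ : mu Z \is a fin_num by rewrite ge0_fin_numE // probability_fin.
have Zpos : 0 < fine (mu Z).
  by rewrite -lte_fin fineK // lt0e measure_ge0 andbT; apply/eqP.
have Z2 : 0 < fine (mu Z) / 2 by rewrite divr_gt0.
have [C [wC CZ hC]] := well_split_subset Kc Vm fm mZ Z2.
have mC : measurable C by case: wC => ? _ _; exact: (Kmeas Kc).
have [S [mS SC CS injS]] := selection Kc Vm Vsep fm wC.
exists S; split=> //; first exact: subset_trans CZ.
move=> S0; have /hmcp nS : mu.-negligible S by exact/negligibleP.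
have C0 : mu C = 0%E.
  apply: measure_negligible => //; apply: negligibleS nS => x Cx.
  have [y Sy e] := CS _ (ex_intro2 _ _ x Cx erefl); exists y => //.
  by apply/(E_ofP f); exists 1%N, 1%N.
move: hC; rewrite leNgt => /negP; apply.
have -> : mu (Z `\` C) = mu Z.
  have ZC : Z `&` C = C by apply/seteqP; split=> [x []//|x Cx]; split=> //; exact: CZ.
  transitivity (mu Z - mu C)%E; last by rewrite C0 sube0.
  by rewrite measureD ?probability_fin // ZC.
by rewrite -[ltRHS](fineK fZ) lte_fin ltr_pdivrMr // ltr_pMr // ltr1n.
Qed.

(** A union of such sets that is maximal in measure leaves nothing out, by
    [injective_subset]. *)
Lemma injective_cover : exists Y : nat -> set X, [/\ forall k, measurable (Y k),
  forall k, {in Y k &, injective f} & mu (~` \bigcup_k Y k) = 0%E].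
Proof.
pose G := [set S | measurable S /\ {in S &, injective f}].
pose F := [set A | exists Y : nat -> set X, (forall k, G (Y k)) /\ A = \bigcup_k Y k].
have G0 : G set0 by split=> // x y; rewrite inE.
have [A [Y [gY ->]] hY] : exists2 S, F S & forall A, F A -> mu (A `\` S) = 0%E.
  apply: maximal_measure.
  - by move=> _ [Y [gY ->]]; apply: bigcupT_measurable => k; case: (gY k).
  - by exists (fun=> set0); split=> //; rewrite bigcup0.
  - move=> A /choice[Y hY].
    exists (fun k => if unpickle k is Some (i, j) then Y i j else set0); split.
      by move=> k; case: unpickle => [[i j]|//]; case: (hY i).
    apply/seteqP; split=> x.
      move=> [i _]; have [_ ->] := hY i => -[j _ Yx]; exists (pickle (i, j)) => //.
      by rewrite pickleK.
    move=> [k _]; case: unpickle => [[i j] Yx|//]; exists i => //.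
    by have [_ ->] := hY i; exists j.
have mY : measurable (\bigcup_k Y k) by apply: bigcupT_measurable => k; case: (gY k).
exists Y; split; [by move=> k; case: (gY k)|by move=> k; case: (gY k)|].
apply: contrapT => nz.
have [S [mS SZ injS S0]] := injective_subset (measurableC mY) nz.
apply: S0; rewrite -(hY S).
  by congr (mu _); apply/seteqP; split=> x => [Sx|[]//]; split=> //; exact: SZ.
exists (fun k => if k is 0%N then S else set0); split=> [[|k]//|].
by apply/seteqP; split=> [x Sx|x [[|k] _ //]]; exists 0%N.
Qed.

(** This is the Lusin-Novikov theorem up to a null set. *)
Lemma measurable_section : exists (N : set X) (s : nat -> X -> X),
  [/\ measurable N, mu N = 0%E, invariant_set E N, 
   forall k, measurable_fun setT (s k) &
   (forall k x, s k x = x \/ f (s k x) = x) /\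
   forall y, ~ N y -> exists k, s k (f y) = y].
Proof.
have [Y [mY injY Y0]] := injective_cover.
have /choice[I hI] : forall k, exists I,
    [/\ measurable I, I `<=` f @` Y k & mu.-negligible (f @` Y k `\` I)].
  by move=> k; exact: image_measurable_ae.
have /choice[J hJ] : forall k, exists J : nat -> set X, forall n,
    [/\ measurable (J n), J n `<=` f @` (Y k `&` V n)
      & mu.-negligible (f @` (Y k `&` V n) `\` J n)].
  move=> k; have [J hJ] := choice (fun n => image_measurable_ae (measurableI _ _ (mY k) (Vm n))).
  by exists J.
have [N [mN N0 iN subN]] : exists N, [/\ measurable N, mu N = 0%E, invariant_set E N &
   ~` (\bigcup_k Y k) `|` (\bigcup_k (f @` Y k `\` I k)) `|`
   \bigcup_k \bigcup_n (f @` (Y k `&` V n) `\` J k n) `<=` N].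
  apply: invariant_null; apply: negligibleU; first apply: negligibleU.
  - by apply/negligibleP => //; apply: measurableC; exact: bigcupT_measurable.
  - by apply: negligible_bigcup => k; case: (hI k).
  - by apply: negligible_bigcup => k; apply: negligible_bigcup => n; case: (hJ k n).
(* Off the null set [N], [D k] and [J k n] are the images of [Y k] and of its
   trace on [V n]; outside [D k] the section [s k] is completed by the identity. *)
pose D k := I k `\` N.
have mD k : measurable (D k) by apply: measurableD => //; case: (hI k).
have /choice[s hs] : forall k, exists s : X -> X, forall x,
    (D k x -> Y k (s x) /\ f (s x) = x) /\ (~ D k x -> s x = x).
  move=> k.
  have /choice[s hs] : forall x, exists y, (D k x -> Y k y /\ f y = x) /\ (~ D k x -> y = x).
    move=> x; have [Dx|nD] := pselect (D k x); last by exists x.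
    by case: (hI k) => _ /(_ _ Dx.1)[y Yy fy] _; exists y; split.
  by exists s.
exists N, s; split=> //; last first.
  split=> [k x|y nNy].
    have [Dx|nDx] := pselect (D k x); first by right; case: ((hs k x).1 Dx).
    by left; case: (hs k x) => _ ->.
  have [k _ Yy] : (\bigcup_k Y k) y.
    by apply: contrapT => nY; apply: nNy; apply: subN; left; left.
  have nNfy : ~ N (f y) by apply: (invariant_setC iN (E_f f y)).
  have Dfy : D k (f y).
    split=> //; apply: contrapT => nI; apply: nNfy; apply: subN; left; right.
    by exists k => //; split=> //; exists y.
  have [Ys fs] := (hs k _).1 Dfy.
  by exists k; apply: (injY k); rewrite ?inE.
move=> k _; rewrite -/(measurable_fun setT (s k)).
suff hm : measurable `<=` [set B | measurable (s k @^-1` B)].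
  by move=> B mB; rewrite setTI; exact: hm.
apply: Vgen => [|A|A hA|n]; rewrite /mkset.
- by rewrite preimage_set0.
- by rewrite -preimage_setC => ?; exact: measurableC.
- by rewrite preimage_bigcup; exact: bigcupT_measurable.
rewrite (_ : _ @^-1` _ = (J k n `\` N) `|` (V n `\` D k)).
  by apply: measurableU; apply: measurableD => //; case: (hJ k n).
apply/seteqP; split=> x.
  rewrite /preimage /mkset => Vs; have [Dx|nDx] := pselect (D k x); last first.
    by right; split=> //; rewrite -((hs k x).2 nDx).
  left; split; last by case: Dx.
  have [Ys fs] := (hs k x).1 Dx.
  apply: contrapT => nJ; case: Dx => _; apply; apply: subN; right; exists k => //.
  by exists n => //; split=> //; exists (s k x).
case=> [[Jx nNx]|[Vx nDx]]; last by rewrite /preimage /mkset (hs k x).2.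
case: (hJ k n) => _ /(_ _ Jx)[y [Yy Vy] fy] _.
have Dx : D k x.
  split=> //; apply: contrapT => nI; apply: nNx; apply: subN; left; right.
  by exists k => //; split=> //; exists y.
have [Ys fs] := (hs k x).1 Dx.
suff e : y = s k x by rewrite /preimage /mkset -e.
by apply: (injY k); rewrite ?inE // fy.
Qed.

Lemma measurable_iter n : measurable_fun setT (iter n f).
Proof.
elim: n => [|n IH]; first exact: measurable_id.
exact: (measurableT_comp fm IH).
Qed.

(** Each point of the class of [x] is obtained by applying [f] a number of times
    and then a finite sequence of sections. *)
Theorem measurable_enumeration : exists (N : set X) (g : nat -> X -> X),
  [/\ measurable N, mu N = 0%E, invariant_set E N,
   forall k, measurable_fun setT (g k) &
   forall x, ~ N x -> forall y, E (x, y) <-> exists k, y = g k x].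
Proof.
have [N [s [mN N0 iN ms [sE hs]]]] := measurable_section.
pose G (p : nat * seq nat) (x : X) := foldl (fun z k => s k z) (iter p.1 f x) p.2.
pose g k := if unpickle k is Some p then G p else id.
exists N, g; split=> //.
  move=> k; rewrite /g; case: unpickle => [[n w]|]; last exact: measurable_id.
  rewrite /G /=; elim/last_ind: w => [|w a IH]; first exact: measurable_iter.
  rewrite (_ : (fun x => _) = s a \o (fun x => foldl (fun z k => s k z) (iter n f x) w)).
    exact: measurableT_comp.
  by apply/funext => x; rewrite -cats1 foldl_cat.
have EG p x : E (x, G p x).
  case: p => n w; rewrite /G /=; elim/last_ind: w => [|w a IH]; first exact: E_iter.
  rewrite -cats1 foldl_cat /=; apply: E_trans IH _.
  set z := foldl _ _ _; case: (sE a z) => h; first by rewrite h; exact: E_refl.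
  by rewrite -{1}h; apply: E_sym; exact: E_f.
move=> x nNx y; split=> [xy|[k ->]]; last first.
  by rewrite /g; case: unpickle => [p|]; [exact: EG|exact: E_refl].
suff [p ->] : exists p, y = G p x by exists (pickle p); rewrite /g pickleK.
have [m [n e]] : exists m n, iter m f x = iter n f y by apply/E_ofP.
suff [w hw] : exists w, y = foldl (fun z k => s k z) (iter n f y) w.
  by exists (m, w); rewrite /G /= e.
have {xy} nNy : ~ N y by exact: (invariant_setC iN xy).
elim: n y {e} nNy => [|n IH] y nNy; first by exists [::].
have nNfy : ~ N (f y) by exact: (invariant_setC iN (E_f f y)).
have [w hw] := IH _ nNfy; have [k hk] := hs y nNy.
by exists (rcons w k); rewrite -cats1 foldl_cat /= -iterS iterSr -hw hk.
Qed.

End MeasurableSections.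

(** * Mass transport *)

Section AlmostEverywhere.
Context (R : realType) (d : measure_display) (X : measurableType d).
Variable mu : probability X R.
Variable f : X -> X.
Hypothesis fm : measurable_fun setT f.
Hypothesis facyc : acyclic f.
Local Notation E := (E_of f).
Hypothesis hmcp : mcp mu E.
Hypothesis hns : nowhere_smooth mu E.
Variable rho : X * X -> R.
Hypothesis hrho : radon_nikodym_cocycle mu E rho.
Variable V : nat -> set X.
Hypotheses (Vm : forall n, measurable (V n)) (Vsep : separating V).

Lemma measurable_diagonal : measurable [set p : X * X | p.1 = p.2].
Proof.
rewrite (_ : mkset _ = ~` \bigcup_n ((V n `*` ~` V n) `|` (~` V n `*` V n))).
  apply/measurableC/bigcupT_measurable => n; apply: measurableU;
    by apply: measurableX => //; exact: measurableC.
apply/seteqP; split=> -[x y] /=; first by move=> -> [n _ [[]|[]]].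
move=> h; apply: Vsep => n; split=> Vn; apply: contrapT => nV; apply: h; exists n => //.
  by left.
by right.
Qed.

Lemma measurable_eq_set d' (Y : measurableType d') (h1 h2 : Y -> X) :
  measurable_fun setT h1 -> measurable_fun setT h2 ->
  measurable [set y | h1 y = h2 y].
Proof.
move=> m1 m2.
have := measurable_fun_pair m1 m2 measurableT measurable_diagonal.
by rewrite setTI.
Qed.

Lemma measurable_iter_fst m : measurable_fun setT (fun p : X * X => iter m f p.1).
Proof. exact: (measurableT_comp (measurable_iter fm m) measurable_fst). Qed.
Lemma measurable_iter_snd m : measurable_fun setT (fun p : X * X => iter m f p.2).
Proof. exact: (measurableT_comp (measurable_iter fm m) measurable_snd). Qed.

Lemma measurable_E : measurable E.
Proof.
rewrite (_ : E = \bigcup_m \bigcup_n [set p | iter m f p.1 = iter n f p.2]).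
  apply: bigcupT_measurable => m; apply: bigcupT_measurable => n.
  by apply: measurable_eq_set; [exact: measurable_iter_fst|exact: measurable_iter_snd].
apply/seteqP; split=> -[x y].
  by case/E_ofP => m [n e]; exists m => //; exists n.
by case=> m _ [n _ e]; apply/E_ofP; exists m, n.
Qed.

Lemma measurable_back : measurable [set p | back f p.1 p.2].
Proof.
rewrite (_ : mkset _ = \bigcup_n [set p | iter n f p.2 = p.1]).
  apply: bigcupT_measurable => n; apply: measurable_eq_set.
    exact: measurable_iter_snd.
  exact: measurable_fst.
by apply/seteqP; split=> -[x y] [n]; [exists n|move=> _ ?; exists n].
Qed.

Lemma rho_gt0 x y : E (y, x) -> 0 < rho (y, x). Proof. by case: hrho => _ h _ _ /h. Qed.
Lemma rho_mul x y z : E (z, y) -> E (y, x) -> rho (z, y) * rho (y, x) = rho (z, x).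
Proof. by case: hrho => _ _ h _; exact: h. Qed.
Lemma rho_id x : rho (x, x) = 1.
Proof.
have xx := E_refl f x; have := rho_mul xx xx.
by move=> /(canRL (mulfK (lt0r_neq0 (rho_gt0 xx)))); rewrite divff // lt0r_neq0 // rho_gt0.
Qed.
Lemma rho_inv x y : E (x, y) -> rho (x, y) * rho (y, x) = 1.
Proof. by move=> xy; rewrite rho_mul ?rho_id //; exact: E_sym. Qed.

Lemma measurable_rho d' (Y : measurableType d') (h1 h2 : Y -> X) :
  measurable_fun setT h1 -> measurable_fun setT h2 -> (forall y, E (h1 y, h2 y)) ->
  measurable_fun setT (fun y => rho (h1 y, h2 y)).
Proof.
move=> m1 m2 h; apply: (@measurable_comp _ _ _ _ _ _ E rho setT (fun y => (h1 y, h2 y))).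
- exact: measurable_E.
- by move=> _ [y _ <-]; exact: h.
- by case: hrho.
- exact: measurable_fun_pair.
Qed.

(** A change of base point multiplies the weights by a constant. *)
Lemma rho_infinite_base x z D : (forall y, D y -> E (y, x)) -> E (x, z) ->
  rho_infinite rho x D -> rho_infinite rho z D.
Proof.
move=> hD xz; rewrite /rho_infinite => h.
have zx := E_sym xz; have r0 := rho_gt0 zx.
have := @esum_scale_le R _ D (fun y => rho (y, z)) (rho (z, x)) r0.
rewrite (@eq_esum _ _ _ _ (fun y => (rho (y, x))%:E)); last first.
  by move=> y Dy; rewrite rho_mul //; exact: E_trans (hD _ Dy) xz.
rewrite h => h'; apply/eqP; rewrite -leye_eq.
have {}h' := h' (fun y Dy => ltW (rho_gt0 (E_trans (hD _ Dy) xz))).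
move: h'; case: (\esum_(y in D) _) => [s| |] //.
by rewrite mulrNy gtr0_sg // mul1e.
Qed.

Variables (N : set X) (g : nat -> X -> X).
Hypotheses (mN : measurable N) (N0 : mu N = 0%E) (iN : invariant_set E N).
Hypothesis gm : forall k, measurable_fun setT (g k).
Hypothesis gE : forall x, ~ N x -> forall y, E (x, y) <-> exists k, y = g k x.

Lemma measurable_ex (D : set (X * X)) : measurable D ->
  measurable [set x | ~ N x /\ exists y, E (x, y) /\ D (x, y)].
Proof.
move=> mD; rewrite (_ : mkset _ = ~` N `&` \bigcup_k [set x | D (x, g k x)]).
  apply: measurableI; first exact: measurableC.
  apply: bigcupT_measurable => k.
  by apply: (@measurable_preimage _ _ _ _ (fun x => (x, g k x))) => //; exact: measurable_fun_pair.
apply/seteqP; split=> x [nN].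
  by move=> [y [/(gE nN)[k ->] Dy]]; split=> //; exists k.
by move=> [k _ Dk]; split=> //; exists (g k x); split=> //; apply/gE => //; exists k.
Qed.

(** The index [k] is kept if [g k x] is not listed before; this removes the
    repetitions from the enumeration of the class of [x]. *)
Let first_hit k := [set x | forall j, (j < k)%N -> g j x <> g k x].

Lemma measurable_first_hit k : measurable (first_hit k).
Proof.
rewrite (_ : first_hit k = \bigcap_(j in [set j | (j < k)%N]) ~` [set x | g j x = g k x]).
  by apply: bigcap_measurableType => j _; apply/measurableC/measurable_eq_set.
by apply/seteqP; split=> x h j /h.
Qed.

Lemma esum_class x (a : X -> \bar R) : ~ N x -> (forall y, (0 <= a y)%E) ->
  \esum_(y in xsection E x) a y =
  (\sum_(0 <= k <oo) (if `[<first_hit k x>] then a (g k x) else 0))%E.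
Proof.
move=> nN a0.
rewrite (_ : xsection E x = (g^~ x) @` [set k | `[<first_hit k x>]]).
  rewrite (esum_pred_image a (g^~ x) (fun k => `[<first_hit k x>])) //.
    by rewrite eseries_mkcond.
  move=> i j /set_mem /asboolP hi /set_mem /asboolP hj e.
  by have [ij|ji|//] := ltngtP i j; [case: (hj i ij)|case: (hi j ji)].
apply/seteqP; split=> y.
  move=> /set_mem /(gE nN)[k e].
  have hP : exists j, `[<y = g j x>] by exists k; apply/asboolP.
  case: (ex_minnP hP) => j /asboolP ej hj; exists j => //; apply/asboolP => i ij ei.
  by have := hj i; rewrite ei -ej => /(_ (asboolT erefl)); rewrite leqNgt ij.
by move=> [k _ <-]; apply/mem_set/(gE nN); exists k.
Qed.

Lemma measurable_esum_class (a : X * X -> \bar R) : (forall p, (0 <= a p)%E) ->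
  (forall k, measurable_fun setT (fun x => a (x, g k x))) ->
  measurable_fun (~` N) (fun x => \esum_(y in xsection E x) a (x, y)).
Proof.
move=> a0 ma; apply: (eq_measurable_fun (fun x =>
  (\sum_(0 <= k <oo) (((fun x => a (x, g k x)) \_ (first_hit k)) x))%E)).
  move=> x; rewrite inE => nN; rewrite esum_class //.
apply: (measurable_funS measurableT) => //.
have := @ge0_emeasurable_sum _ X R setT (fun k => (fun x => a (x, g k x)) \_ (first_hit k)) predT.
apply=> [k x _ _|k _]; first by rewrite patchE; case: ifP.
apply: (measurable_restrictT _ (measurable_first_hit k)).1; exact: measurable_funTS.
Qed.

Definition weight (D : set (X * X)) x := \esum_(y in [set y | D (x, y)]) (rho (y, x))%:E.
(** The mass received by [y], to which each sender contributes
    [rho (y, x) * rho (x, y) = 1]. *)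
Definition indegree (D : set (X * X)) y : \bar R := \esum_(x in [set x | D (x, y)]) (1 : R)%:E.

Section OneRelation.
Variable D : set (X * X).
Hypotheses (mD : measurable D) (DE : D `<=` E) (DN : forall x y, D (x, y) -> ~ N x).

Let sent (p : X * X) : \bar R := if p \in D then (rho (p.2, p.1))%:E else 0%E.
Let received (p : X * X) : \bar R := if (p.2, p.1) \in D then (1 : R)%:E else 0%E.

Lemma weightE x : weight D x = \esum_(y in xsection E x) sent (x, y).
Proof.
rewrite /weight esum_mkcond [RHS]esum_mkcond; apply: eq_esum => y _.
rewrite /xsection /sent; case: ifPn => [|/negP h].
  by rewrite inE /= => Dxy; rewrite !mem_set //=; apply: mem_set; apply: DE.
by case: ifP => // _; rewrite memNset // => Dxy; apply: h; rewrite inE.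
Qed.

Lemma indegreeE x : indegree D x = \esum_(y in xsection E x) received (x, y).
Proof.
rewrite /indegree esum_mkcond [RHS]esum_mkcond; apply: eq_esum => y _.
rewrite /xsection /received /=; case: ifPn => [|/negP h].
  rewrite inE /= => Dxy; rewrite !mem_set //=; apply: mem_set; apply: E_sym; exact: DE.
by case: ifP => // _; rewrite memNset // => Dxy; apply: h; rewrite inE.
Qed.

Lemma sent_ge0 p : (0 <= sent p)%E.
Proof.
rewrite /sent; case: ifPn => // /set_mem Dp; rewrite lee_fin ltW // rho_gt0 //.
by apply: E_sym; apply: DE; case: p Dp.
Qed.

Lemma received_ge0 p : (0 <= received p)%E.
Proof. by rewrite /received; case: ifP => _ //; rewrite lee_fin. Qed.

Lemma measurable_sent : measurable_fun E sent.
Proof.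
rewrite (_ : sent = (fun p => (rho (p.2, p.1))%:E) \_ D); last first.
  by apply/funext => p; rewrite patchE.
apply/(measurable_restrict _ mD measurable_E); apply: (measurable_funS measurable_E).
  exact: subIsetl.
apply/measurable_EFinP.
apply: (@measurable_comp _ _ _ _ _ _ E rho E (fun p => (p.2, p.1))).
- exact: measurable_E.
- by move=> _ [[x y] /E_sym h <-].
- by case: hrho.
- apply: measurable_funTS; apply: measurable_fun_pair.
    exact: measurable_snd.
  exact: measurable_fst.
Qed.

Lemma extend_measurable (h : X -> \bar R) : measurable_fun (~` N) h ->
  (forall x, N x -> h x = 0%E) -> measurable_fun setT h.
Proof.
move=> mh h0; rewrite (_ : h = h \_ (~` N)).
  by apply: (measurable_restrictT _ (measurableC mN)).1.
apply/funext => x; rewrite patchE; case: ifPn => // /negP nx.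
by rewrite h0 //; apply: contrapT => nN; apply: nx; rewrite inE.
Qed.

Lemma measurable_weight : measurable_fun setT (weight D).
Proof.
apply: extend_measurable; last first.
  by move=> x Nx; rewrite /weight esum1 // => y /DN.
rewrite (_ : weight D = fun x => \esum_(y in xsection E x) sent (x, y)); last first.
  by apply/funext => x; exact: weightE.
rewrite (_ : (fun x => _) = fun x => \esum_(y in xsection E x)
   (fun p => if p \in E then sent p else 0%E) (x, y)); last first.
  by apply/funext => x; apply: eq_esum => y /set_mem xy; rewrite mem_set.
apply: (@measurable_esum_class (fun p => if p \in E then sent p else 0%E)).
  by move=> p; case: ifP => _ //; exact: sent_ge0.
move=> k; rewrite (_ : (fun x => _) = (fun p => if p \in E then sent p else 0%E) \o
   (fun x => (x, g k x))) //.
apply: measurableT_comp; last exact: measurable_fun_pair.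
rewrite (_ : (fun p => _) = sent \_ E); last by apply/funext => p; rewrite patchE.
by apply: (measurable_restrictT _ measurable_E).1; exact: measurable_sent.
Qed.

Lemma measurable_indegree : measurable_fun setT (indegree D).
Proof.
apply: extend_measurable; last first.
  move=> x Nx; rewrite /indegree esum1 // => y Dyx; case: (DN Dyx).
  by apply: iN Nx; apply: E_sym; exact: DE.
rewrite (_ : indegree D = fun x => \esum_(y in xsection E x) received (x, y)); last first.
  by apply/funext => x; exact: indegreeE.
apply: measurable_esum_class; first exact: received_ge0.
move=> k; rewrite (_ : (fun x => _) = (cst (1%:E : \bar R)) \_ [set x | D (g k x, x)]).
  have mDk : measurable [set x | D (g k x, x)].
    apply: (@measurable_preimage _ _ _ _ (fun x => (g k x, x))) => //.
    exact: measurable_fun_pair.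
  by apply: (measurable_restrictT _ mDk).1; exact: measurable_cst.
by apply/funext => x; rewrite patchE /received /=; case: ifPn.
Qed.

Lemma mass_transport : (\int[mu]_x weight D x = \int[mu]_x indegree D x)%E.
Proof.
case: hrho => _ _ _ /(_ sent measurable_sent (fun p _ => sent_ge0 p)) h.
transitivity (\int[mu]_x (\esum_(y in xsection E x) sent (x, y))%R)%E.
  by apply: eq_integral => x _; exact: weightE.
rewrite h; apply: eq_integral => x _; rewrite indegreeE.
apply: eq_esum => y /set_mem /= xy; rewrite /sent /received /=.
by case: ifP => _; rewrite ?mul0e // -EFinM rho_inv.
Qed.

Lemma weight_ge0 x : (0 <= weight D x)%E.
Proof. by rewrite weightE; apply: esum_ge0 => y _; exact: sent_ge0. Qed.
Lemma indegree_ge0 x : (0 <= indegree D x)%E.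
Proof. by rewrite indegreeE; apply: esum_ge0 => y _; exact: received_ge0. Qed.

Lemma integral_bounded (h : X -> \bar R) (C : R) : measurable_fun setT h ->
  (forall x, (0 <= h x)%E) -> (forall x, (h x <= C%:E)%E) -> (\int[mu]_x h x < +oo)%E.
Proof.
move=> mh h0 hC; apply: (@le_lt_trans _ _ (\int[mu]_x (cst C%:E) x)%E).
  by apply: ge0_le_integral => //; exact: measurable_cst.
have -> : (\int[mu]_x (cst C%:E) x = C%:E * mu setT)%E by rewrite integral_cst.
by rewrite probability_setT mule1 ltry.
Qed.

Lemma ae_finite (h : X -> \bar R) : measurable_fun setT h ->
  (forall x, (0 <= h x)%E) -> (\int[mu]_x h x < +oo)%E ->
  \forall x \ae mu, (h x < +oo)%E.
Proof.
move=> mh h0 ih.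
have : mu.-integrable setT h.
  apply/integrableP; split=> //.
  by under eq_integral do rewrite gee0_abs //.
move=> /(integrable_ae measurableT); apply: filterS => x /(_ I).
by rewrite ge0_fin_numE.
Qed.

Lemma bounded_weight_finite (C : R) : (forall x, (weight D x <= C%:E)%E) ->
  \forall y \ae mu, finite_set [set x | D (x, y)].
Proof.
move=> hC; have : (\int[mu]_x indegree D x < +oo)%E.
  rewrite -mass_transport; apply: integral_bounded hC; first exact: measurable_weight.
  exact: weight_ge0.
move/(ae_finite measurable_indegree indegree_ge0); apply: filterS => y.
exact: esum1_finite.
Qed.

Lemma functional_weight_finite : (forall x x' y, D (x, y) -> D (x', y) -> x = x') ->
  \forall x \ae mu, (weight D x < +oo)%E.
Proof.
move=> hf; apply: ae_finite; [exact: measurable_weight|exact: weight_ge0|].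
rewrite mass_transport; apply: (@integral_bounded _ 1); first exact: measurable_indegree.
  exact: indegree_ge0.
move=> y; have [[x Dx]|nD] := pselect (exists x, D (x, y)); last first.
  by rewrite /indegree esum1 ?lee_fin // => x Dx; case: nD; exists x.
rewrite /indegree (_ : mkset _ = [set x]); first by rewrite esum_set1 // lee_fin.
by apply/seteqP; split=> [z Dz|z ->//]; exact: hf Dz Dx.
Qed.

End OneRelation.

Lemma ae_notN : \forall x \ae mu, ~ N x.
Proof. by exists N; split=> // x /contrapT. Qed.

Lemma invN x y : E (x, y) -> ~ N x -> ~ N y.
Proof. by move=> xy; apply: (invariant_setC iN xy). Qed.

Lemma null_ae (A : set X) : measurable A -> mu A = 0%E -> \forall x \ae mu, ~ A x.
Proof. by move=> mA A0; exists A; split=> // x /contrapT. Qed.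

Lemma ae_null (A : set X) : measurable A -> (\forall x \ae mu, ~ A x) -> mu A = 0%E.
Proof.
move=> mA [B [mB B0 AB]]; apply: measure_negligible => //; exists B; split=> // x Ax.
by apply: AB => /= /(_ Ax).
Qed.

(** * Null sections *)

(** The saturation within the set where the classes are enumerated, which makes
    it measurable. *)
Definition sat (A : set X) := [set x | ~ N x /\ exists y, E (x, y) /\ A y].

Lemma measurable_sat A : measurable A -> measurable (sat A).
Proof.
move=> mA; apply: (measurable_ex (D := [set p | A p.2])).
exact: (@measurable_preimage _ _ _ _ (@snd X X) A measurable_snd mA).
Qed.

Lemma invariant_sat A : invariant_set E (sat A).
Proof.
move=> x y xy [nN [z [xz Az]]]; split; first exact: invN nN.
by exists z; split=> //; exact: E_trans (E_sym xy) xz.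
Qed.

(** Go through the sets [V n] and, in each class, drop the points outside [V n]
    if there remain points inside. *)
Let thin M : nat -> set X := fix F n :=
  if n is k.+1 then (F k `&` V k) `|` (F k `\` sat (F k `&` V k)) else M.

(** If [M] is finite in each class, [thin M] keeps a nonempty set forever, and its
    intersection is a transversal because the sets [V n] separate points. *)
Lemma finite_section_null_enumerated M : measurable M -> M `<=` ~` N ->
  (forall x, M x -> finite_set (M `&` [set y | E (x, y)])) -> mu M = 0%E.
Proof.
move=> mM MN hfin; pose F := thin M.
have mF n : measurable (F n).
  elim: n => //= n IH; apply: measurableU; first exact: measurableI.
  by apply: measurableD => //; apply: measurable_sat; exact: measurableI.
have dF n : F n.+1 `<=` F n by move=> x [[]|[]].
have FM n : F n `<=` M by elim: n => // n IH; exact: subset_trans (dF n) IH.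
have neF x n : sat M x -> (F n `&` [set y | E (x, y)]) !=set0.
  move=> [nN [y [xy My]]]; elim: n => [|n [z [Fz xz]]]; first by exists y.
  have [[w [[Fw Vw] xw]]|nF] := pselect (((F n `&` V n) `&` [set y | E (x, y)]) !=set0).
    by exists w; split=> //; left.
  exists z; split=> //; right; split=> // -[_ [w [zw Fw]]]; apply: nF; exists w.
  by split=> //; exact: E_trans xz zw.
pose S := \bigcap_n F n.
have mS : measurable S by exact: bigcapT_measurable.
have satM : smooth_on E (sat M).
  exists S; split=> //.
    by move=> x /(_ 0%N I) Mx; split; [exact: MN|exists x; split=> //; exact: E_refl].
  move=> x sx; have [nN [x1 [xx1 Mx1]]] := sx.
  have [y hy] : \bigcap_n (F n `&` [set y | E (x, y)]) !=set0.
    apply: (@finite_decreasing _ (M `&` [set y | E (x1, y)])).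
    - exact: hfin.
    - move=> n y [/FM My xy]; split=> //; exact: E_trans (E_sym xx1) xy.
    - by move=> n y [/dF].
    - by move=> n; exact: neF.
  have Sy : S y by move=> n _; case: (hy n I).
  have xy : E (x, y) by case: (hy 0%N I).
  exists y; split=> // z [Sz xz]; apply: Vsep => n.
  have aux u v : S u -> S v -> E (x, u) -> E (x, v) -> V n u -> V n v.
    move=> Su Sv xu xv Vu; have /= := Sv n.+1 I => -[[]//|[_ h]].
    case: h; split; first exact: invN xv nN.
    exists u; split; first exact: E_trans (E_sym xv) xu.
    by split=> //; exact: Su.
  by split; apply: aux.
have msat : measurable (sat M) by exact: measurable_sat.
have sat0 : mu (sat M) = 0%E.
  apply: contrapT => nz; apply: hns; exists (sat M); split=> //.
    exact: invariant_sat.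
  by rewrite lt0e measure_ge0 andbT; exact/eqP.
apply: measure_negligible => //; exists (sat M); split=> // x Mx.
by split; [exact: MN|exists x; split=> //; exact: E_refl].
Qed.

Lemma finite_section_null M : measurable M ->
  (\forall x \ae mu, M x -> finite_set (M `&` [set y | E (x, y)])) -> mu M = 0%E.
Proof.
move=> mM /(ae_invariant hmcp)[N1 [mN1 N10 iN1 h]].
have : mu (M `\` (N1 `|` N)) = 0%E.
  apply: finite_section_null_enumerated.
  - by apply: measurableD => //; exact: measurableU.
  - by move=> x [_ nx] Nx; apply: nx; right.
  - move=> x [Mx nx]; have : finite_set (M `&` [set y | E (x, y)]).
      by apply: h => // N1x; apply: nx; left.
    by apply: sub_finite_set => y [[My _] xy].
move=> M0; have mM' : measurable (M `\` (N1 `|` N)).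
  by apply: measurableD => //; exact: measurableU.
apply: ae_null => //; have := null_ae mM' M0.
apply: filterS2 (filterI ae_notN (null_ae mN1 N10)) => x [nN nN1] nM' Mx.
by apply: nM'; split=> // -[].
Qed.

Lemma finite_section_avoid M : measurable M ->
  (\forall x \ae mu, M x -> finite_set (M `&` [set y | E (x, y)])) ->
  \forall x \ae mu, forall y, E (x, y) -> ~ M y.
Proof.
by move=> mM /(finite_section_null mM) /(null_ae mM) /(ae_class hmcp).
Qed.

Lemma transversal_avoid M : measurable M ->
  (\forall x \ae mu, forall y z, M y -> M z -> E (x, y) -> E (x, z) -> y = z) ->
  \forall x \ae mu, forall y, E (x, y) -> ~ M y.
Proof.
move=> mM h; apply: finite_section_avoid => //; apply: filterS h => x h Mx.
apply: (sub_finite_set _ (finite_set1 x)) => y [My xy].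
by apply/esym; apply: h => //; exact: E_refl.
Qed.

(** * The mass behind a point *)

Definition back_weight x : \bar R := \esum_(y in back f x) (rho (y, x))%:E.
Definition heavy := [set x | ~ N x /\ back_weight x = +oo%E].

Let Dback := [set p : X * X | ~ N p.1 /\ back f p.1 p.2].

Lemma measurable_Dback : measurable Dback.
Proof.
apply: measurableI; last exact: measurable_back.
exact: (@measurable_preimage _ _ _ _ (@fst X X) (~` N) measurable_fst (measurableC mN)).
Qed.

Lemma Dback_weight x : ~ N x -> weight Dback x = back_weight x.
Proof.
by move=> nN; congr esum; apply/seteqP; split=> y; [case|move=> ?; split].
Qed.

Lemma DbackE : Dback `<=` E.
Proof. by move=> [x y] [_ /E_back]. Qed.

Lemma back_weight_oo_E x y : E (x, y) -> back f x `<=` back f y ->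
  back_weight x = +oo%E -> back_weight y = +oo%E.
Proof.
move=> xy h hx; apply: (esum_subset_oo h).
apply: (rho_infinite_base _ xy hx) => z /E_back; exact: E_sym.
Qed.

Lemma back_f x : back f x `<=` back f (f x).
Proof. by move=> y [n <-]; exists n.+1. Qed.

Lemma heavy_forward : forward_closed f heavy.
Proof.
move=> x [nN hx]; split; first exact: invN (E_f f x) nN.
exact: back_weight_oo_E (E_f f x) (@back_f x) hx.
Qed.

Lemma measurable_heavy : measurable heavy.
Proof.
have mw := measurable_weight measurable_Dback DbackE (fun x y h => proj1 h).
rewrite (_ : heavy = ~` N `&` [set x | (+oo <= weight Dback x)%E]).
  apply: measurableI; first exact: measurableC.
  by rewrite -[mkset _]setTI; apply: emeasurable_fun_c_infty.
apply/seteqP; split=> x [nN h]; split=> //=; first by rewrite Dback_weight // h.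
by move: h; rewrite /mkset Dback_weight // leye_eq => /eqP.
Qed.

Lemma measurable_back_weight_le (C : R) :
  measurable [set x | ~ N x /\ (back_weight x <= C%:E)%E].
Proof.
have mw := measurable_weight measurable_Dback DbackE (fun x y h => proj1 h).
rewrite (_ : mkset _ = ~` N `&` [set x | (weight Dback x <= C%:E)%E]).
  apply: measurableI; first exact: measurableC.
  by rewrite -[mkset _]setTI; apply: emeasurable_fun_infty_c.
by apply/seteqP; split=> x [nN h]; split=> //=; move: h; rewrite /mkset Dback_weight.
Qed.

(** Let each point [x] of [A] send mass to the points behind it.  The mass sent is
    at most [C], so almost every [y] has finitely many senders, which are the
    visits of its orbit to [A]. *)
Lemma light_visits_finite (A : set X) (C : R) : measurable A ->
  (forall x, A x -> ~ N x /\ (back_weight x <= C%:E)%E) ->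
  \forall y \ae mu, finite_set [set n | A (iter n f y)].
Proof.
move=> mA hA.
have mD : measurable (Dback `&` [set p | A p.1]).
  apply: measurableI; first exact: measurable_Dback.
  exact: (@measurable_preimage _ _ _ _ (@fst X X) A measurable_fst mA).
have C0 x : A x -> (0%E <= C%:E)%E.
  case/hA => _; apply: le_trans; apply: esum_ge0 => y /E_back yx.
  by rewrite lee_fin ltW // rho_gt0 //; exact: E_sym.
have hw x : (weight (Dback `&` [set p | A p.1]) x <= (Num.max C 0)%:E)%E.
  have [Ax|nAx] := pselect (A x); last first.
    by rewrite /weight esum1 ?lee_fin ?le_max ?lexx ?orbT // => y [].
  have [nN hx] := hA _ Ax; apply: (@le_trans _ _ C%:E); last by rewrite lee_fin le_max lexx.
  apply: le_trans hx; rewrite -Dback_weight //; apply: esum_subset.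
  by move=> y [].
have := bounded_weight_finite mD (subset_trans (@subIsetl _ _ _) DbackE) (fun x y h => h.1.1) hw.
apply: filterS2 ae_notN => y nN hf.
have : finite_set ((fun n => iter n f y) @^-1`
    [set x | (Dback `&` [set p : X * X | A p.1]) (x, y)]).
  by apply: finite_preimage hf => m n _ _; exact: iter_acyclic_inj.
apply: sub_finite_set => n An; split=> //; split; last by exists n.
by case: (hA _ An).
Qed.

Let snd_pre (A : set X) : measurable A -> measurable [set p : X * X | A p.2].
Proof. exact: (@measurable_preimage _ _ _ _ (@snd X X) A measurable_snd). Qed.
Let fst_pre (A : set X) : measurable A -> measurable [set p : X * X | A p.1].
Proof. exact: (@measurable_preimage _ _ _ _ (@fst X X) A measurable_fst). Qed.
Let iter_pre n (A : set X) : measurable A -> measurable [set p : X * X | A (iter n f p.2)].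
Proof.
exact: (@measurable_preimage _ _ _ _ (fun p : X * X => iter n f p.2) A (measurable_iter_snd n)).
Qed.

Lemma back_antisym x y : back f x y -> back f y x -> x = y.
Proof.
move=> [m em] [n en]; have : iter (n + m) f y = iter 0 f y by rewrite iterD em.
by move/(iter_acyclic_inj facyc); case: m em => // m em; rewrite addnS.
Qed.

Lemma back_trans x y z : back f x y -> back f y z -> back f x z.
Proof. by move=> [m <-] [n <-]; exists (m + n)%N; rewrite iterD. Qed.

Let Doff := [set p : X * X | ~ N p.1] `&` (E `&` ~` [set p | back f p.1 p.2]).

Lemma measurable_Doff : measurable Doff.
Proof.
apply: measurableI; first exact: (fst_pre (measurableC mN)).
apply: measurableI; first exact: measurable_E.
by apply: measurableC; exact: measurable_back.
Qed.

(** Let [A] be the set of points [x] such that the mass outside [back f x] is at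
    most [C], and let them send mass to these outside points: almost every [y] is
    behind all but finitely many points of [A].  It follows that each class has
    finitely many minimal points of [A], so that these points form a null set.
    But there is a minimal point behind every point [y] of [A], since only
    finitely many points of [A] are behind [y]. *)
Lemma off_weight_null (C : R) :
  \forall x \ae mu, forall y, E (x, y) -> ~ (~ N y /\ (weight Doff y <= C%:E)%E).
Proof.
have mw := measurable_weight measurable_Doff (fun p h => h.2.1) (fun x y h => h.1).
pose A := [set y | ~ N y /\ (weight Doff y <= C%:E)%E].
have mA : measurable A.
  have -> : A = ~` N `&` [set y | (weight Doff y <= C%:E)%E] by [].
  apply: measurableI; first exact: measurableC.
  by rewrite -[mkset _]setTI; apply: emeasurable_fun_infty_c.
have hw x : (weight (Doff `&` [set p | A p.1]) x <= (Num.max C 0)%:E)%E.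
  have [Ax|nAx] := pselect (A x); last first.
    by rewrite /weight esum1 ?lee_fin ?le_max ?lexx ?orbT // => y [].
  apply: (@le_trans _ _ C%:E); last by rewrite lee_fin le_max lexx.
  by apply: le_trans (proj2 Ax); apply: esum_subset => y [].
have mD : measurable (Doff `&` [set p | A p.1]).
  by apply: measurableI; [exact: measurable_Doff|exact: fst_pre].
have hfin := bounded_weight_finite mD (fun p h => h.1.2.1) (fun x y h => h.1.1) hw.
pose M := A `\` [set x | ~ N x /\ exists y, E (x, y) /\ (back f x y /\ A y /\ x <> y)].
have mM : measurable M.
  apply: measurableD => //.
  apply: (measurable_ex (D := [set p | back f p.1 p.2] `&`
    ([set p | A p.2] `&` ~` [set p | p.1 = p.2]))).
  apply: measurableI; first exact: measurable_back.
  apply: measurableI; first exact: snd_pre.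
  by apply: measurableC; exact: measurable_diagonal.
have Mmin x y : M x -> back f x y -> A y -> x = y.
  move=> [[nN _] h] xy Ay; apply: contrapT => ne; apply: h; split=> //.
  by exists y; split=> //; apply: E_back.
have avoid := @finite_section_avoid M mM.
have {}avoid : \forall x \ae mu, forall y, E (x, y) -> ~ M y.
  apply: avoid; apply: filterS hfin => x hx Mx.
  have [[z [Mz zx]]|nz] := pselect (exists z, M z /\ back f z x).
    apply: (@sub_finite_set _ _ ([set y | (Doff `&` [set p | A p.1]) (y, x)] `|` [set z])).
      move=> y [My xy]; have [yx|nyx] := pselect (back f y x); last first.
        by left; split; [split; [case: My => -[]|split=> //; exact: E_sym]|case: My].
      right; case: yx => i ei; case: zx => j ej.
      have [ij|ji] := leqP i j.
        apply/esym; apply: (Mmin z y) => //; last by case: My.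
        by exists (j - i)%N; rewrite -ei -iterD subnK.
      apply: (Mmin y z) => //; last by case: Mz.
      by exists (i - j)%N; rewrite -ej -iterD subnK // ltnW.
    by rewrite finite_setU; split => //; exact: finite_set1.
  apply: sub_finite_set hx => y [My xy]; split; last by case: My.
  split; first by case: My => -[].
  by split; [exact: E_sym|move=> yx; apply: nz; exists y].
have hfinc := ae_class hmcp hfin.
apply: filterS2 avoid hfinc => x avoid hf y xy Ay.
pose B := A `&` back f y.
have fB : finite_set B.
  apply: (@sub_finite_set _ _ ([set z | (Doff `&` [set p | A p.1]) (z, y)] `|` [set y])).
    move=> z [Az yz]; have [->|ne] := pselect (z = y); first by right.
    left; split=> //; split; first by case: Az.
    split; first by apply: E_sym; exact: E_back.
    by move=> zy; apply: ne; apply: back_antisym.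
  by rewrite finite_setU; split; [exact: hf|exact: finite_set1].
(* Were there no minimal points, one could go backwards in [A] forever. *)
have deep n : exists2 z, B z & exists2 k, (n <= k)%N & iter k f z = y.
  elim: n => [|n [z [Az yz] [k nk ek]]].
    by exists y; [split=> //; exists 0%N|exists 0%N].
  have nM : ~ M z by apply: avoid; apply: E_trans xy _; exact: E_back.
  have [nNz [w [zw [bzw [Aw ne]]]]] : [set x | ~ N x /\
      exists y, E (x, y) /\ (back f x y /\ A y /\ x <> y)] z.
    by apply: contrapT => h; apply: nM; split.
  case: bzw (bzw) => -[|a] ea bzw; first by case: ne.
  exists w; first by split=> //; exact: back_trans yz bzw.
  by exists (k + a.+1)%N; [lia|rewrite iterD ea].
have /choice[h hh] : forall z, exists k, back f y z -> iter k f z = y.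
  by move=> z; have [[k e]|n] := pselect (back f y z); [exists k|exists 0%N].
have [m hm] := finite_set_bounded h fB.
have [z Bz [k mk ek]] := deep m.+1.
have := hm z Bz; have -> : h z = k.
  by apply: (iter_acyclic_inj facyc (x := z)); rewrite ek hh //; case: Bz.
by rewrite leqNgt mk.
Qed.

Lemma forward_half_infinite : \forall x \ae mu, forall z, E (x, z) ->
  rho_infinite rho x ([set y | E (x, y)] `\` back f z).
Proof.
have h : \forall x \ae mu, forall n : nat, forall y, E (x, y) ->
    ~ (~ N y /\ (weight Doff y <= n%:R%:E)%E).
  by apply/ae_foralln => n; exact: off_weight_null.
apply: filterS2 ae_notN h => x nN h z xz.
have nNz := invN xz nN.
have wz : weight Doff z = +oo%E.
  apply: contrapT => nz.
  have wf : (weight Doff z < +oo)%E by rewrite ltey; apply/eqP.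
  have w0 : (0 <= weight Doff z)%E.
    exact: (weight_ge0 (fun p (h : Doff p) => h.2.1)).
  have wfin : weight Doff z \is a fin_num by rewrite ge0_fin_numE.
  apply: (h (Num.truncn (fine (weight Doff z))).+1 z xz); split=> //.
  by rewrite -(fineK wfin) lee_fin; apply: ltW; exact: truncnS_gt.
apply: (rho_infinite_base _ (E_sym xz)); last first.
  apply: esum_subset_oo wz => y [_ [zy nzy]]; split=> //; exact: E_trans xz zy.
by move=> y [xy _]; apply: E_trans (E_sym xy) xz.
Qed.

(** Consider the first entrance of orbits into [Y].  Each point outside [Y] enters
    once, so the points that enter at [x] have a finite total mass for almost
    every [x]; those behind a point [z] outside [Y] all enter where [z] does. *)
Lemma light_outside (Y : set X) : measurable Y -> forward_closed f Y ->
  \forall x \ae mu, forall z, E (x, z) -> (exists y, E (x, y) /\ Y y) ->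
    ~ Y z -> (back_weight z < +oo)%E.
Proof.
move=> mY fY.
pose D := [set p : X * X | ~ N p.1] `&` ([set p : X * X | Y p.1] `&`
  \bigcup_n ([set p : X * X | iter n.+1 f p.2 = p.1] `&` ~` [set p | Y (iter n f p.2)])).
have mD : measurable D.
  apply: measurableI; first exact: (fst_pre (measurableC mN)).
  apply: measurableI; first exact: fst_pre.
  apply: bigcupT_measurable => n; apply: measurableI.
    by apply: measurable_eq_set; [exact: (measurable_iter_snd n.+1)|exact: measurable_fst].
  by apply: measurableC; exact: iter_pre.
have DE : D `<=` E.
  by move=> [x y] [_ [_ [n _ [/= <- _]]]]; apply: E_sym; exact: (E_iter f y n.+1).
have Dfun x x' y : D (x, y) -> D (x', y) -> x = x'.
  move=> [_ [Yx [m _ [/= em nm]]]] [_ [Yx' [n _ [/= en nn]]]].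
  have aux a b u : iter a.+1 f y = u -> Y u -> ~ Y (iter b f y) -> (b <= a)%N.
    move=> eu Yu nb; rewrite leqNgt; apply/negP => ab; apply: nb.
    by rewrite -(subnK ab) iterD eu; exact: forward_closed_iter.
  have mn : m = n.
    apply/eqP; rewrite eqn_leq (aux n m x' en Yx' nm).
    by rewrite (aux m n x em Yx nn).
  by rewrite -em -en mn.
have := ae_class hmcp (functional_weight_finite mD DE (fun x y h => h.1) Dfun).
apply: filterS2 ae_notN => x nN hx z xz [y [xy Yy]] nYz.
have [k0 Yk0] : exists k, Y (iter k f z).
  have /E_ofP[a [b e]] := E_trans (E_sym xz) xy.
  by exists a; rewrite e; exact: forward_closed_iter.
have kP : exists k, `[<Y (iter k f z)>] by exists k0; apply/asboolP.
case: (ex_minnP kP) => -[/asboolP //|k] /asboolP Yk hk.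
have nYk : ~ Y (iter k f z) by move/asboolP/hk; rewrite ltnn.
have zk := E_iter f z k.+1.
have xk := E_trans xz zk.
rewrite ltey; apply/eqP => hz.
have := hx _ xk; rewrite /weight (_ : esum _ _ = +oo%E) ?ltxx //.
apply: (@esum_subset_oo _ _ (back f z)).
  move=> w [m em]; split; first exact: invN xk nN.
  split=> //; exists (k + m)%N => //; rewrite /mkset /= -/(iter (k.+1 + m) f w) !iterD em.
  by split.
apply: (rho_infinite_base _ zk hz) => w /E_back; exact: E_sym.
Qed.

(** * Backward cores and light classes *)

(** Take a set of maximal measure among those that avoid the backward rays in [Y]
    and whose removal leaves a forward closed set.  The points of the rest without
    predecessor could be removed too, so they form a null set. *)
Lemma backward_core (Y : set X) : measurable Y -> forward_closed f Y ->
  exists Z, [/\ measurable Z, Z `<=` Y, forward_closed f Z,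
    (forall r, backray f r -> (forall n, Y (r n)) -> forall n, Z (r n)) &
    \forall x \ae mu, forall y, E (x, y) -> Z y -> exists2 z, Z z & f z = y].
Proof.
move=> mY fY.
pose F := [set Q | [/\ measurable Q, (forall r, backray f r -> (forall n, Y (r n)) ->
   forall n, ~ Q (r n)) & (forall x, Y x -> ~ Q x -> ~ Q (f x))]].
have [Q [mQ rQ fQ] hQ] : exists2 S, F S & forall A, F A -> mu (A `\` S) = 0%E.
  apply: maximal_measure.
  - by move=> A [].
  - by split=> [|r _ _ n|x _ _] //; exact: measurable0.
  - move=> A hA; split.
    + by apply: bigcupT_measurable => n; case: (hA n).
    + by move=> r hr Yr n [k _]; case: (hA k) => _ + _; apply.
    + move=> x Yx nx [k _]; case: (hA k) => _ _; apply => // Ax.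
      by apply: nx; exists k.
pose Z := Y `\` Q.
have mZ : measurable Z by exact: measurableD.
pose P := [set x | ~ N x /\ exists y, E (x, y) /\ (Z y /\ f y = x)].
have mP : measurable P.
  apply: (measurable_ex (D := [set p | Z p.2] `&` [set p | f p.2 = p.1])).
  apply: measurableI; first exact: snd_pre.
  by apply: measurable_eq_set; [exact: (measurable_iter_snd 1)|exact: measurable_fst].
have mQ' : measurable (Q `|` (Z `\` N `\` P)).
  by apply: measurableU => //; apply: measurableD => //; apply: measurableD.
have FQ' : F (Q `|` (Z `\` N `\` P)).
  split=> //.
    move=> r hr Yr n [|[[Zr nN] nP]]; first exact: rQ.
    apply: nP; split=> //; exists (r n.+1); split.
      by rewrite -{1}(hr n); apply: E_sym; exact: E_f.
    by split=> //; split=> //; exact: rQ.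
  move=> x Yx nx [Qf|[[Zf nN] nP]]; first by apply: fQ Qf => // Qx; apply: nx; left.
  apply: nP; split=> //; exists x; split; first by apply: E_sym; exact: E_f.
  by split=> //; split=> // Qx; apply: nx; left.
exists Z; split=> //.
- by move=> x [].
- by move=> x [Yx nQ]; split; [exact: fY|exact: fQ].
- by move=> r hr Yr n; split=> //; exact: rQ.
have := null_ae (measurableD mQ' mQ) (hQ _ FQ').
move=> /(ae_class hmcp); apply: filterS2 ae_notN => x nN h y xy Zy.
apply: contrapT => nz; apply: (h y xy); split; last by case: Zy.
right; split; first by split=> //; exact: invN nN.
by move=> [_ [z [_ [Zz e]]]]; apply: nz; exists z.
Qed.

Lemma finite_large_weight (x : X) (S : set X) (e C : R) : 0 < e ->
  (back_weight x <= C%:E)%E -> (forall y, S y -> back f x y /\ e <= rho (y, x)) ->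
  finite_set S.
Proof.
move=> e0 hC hS; apply: (@esum1_finite R).
apply: (@le_lt_trans _ _ (\esum_(y in S) (rho (y, x) * e^-1)%:E)).
  apply: le_esum => y /hS[_ h]; rewrite lee_fin -(mulfV (lt0r_neq0 e0)).
  by rewrite ler_pM2r // invr_gt0.
apply: le_lt_trans (esum_scale_le _ _) _; first by rewrite invr_gt0.
  move=> y /hS[h _]; apply: ltW; apply: rho_gt0; apply: E_sym; exact: E_back.
apply: (@le_lt_trans _ _ ((e^-1)%:E * C%:E)%E); last by rewrite -EFinM ltry.
apply: lee_wpmul2l; first by rewrite lee_fin invr_ge0 ltW.
by apply: le_trans hC; apply: esum_subset => y /hS[].
Qed.

Lemma back_not_all r z : backray f r -> ~ forall n, back f (r n) z.
Proof.
move=> hr h; have [a ea] := h 0%N; have [b eb] := h a.+1.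
have := backray_iter a.+1 0 hr; rewrite addn0 -eb -iterD -ea.
by move/(iter_acyclic_inj facyc); lia.
Qed.

(** The orbit of [y] visits [A] finitely often, so the weights of [y] relative to
    the visited points have a positive minimum; outside a set of small measure
    one bound is good for all [y]. *)
Lemma bad_level (A : set X) (C e : R) : measurable A -> 0 < e ->
  (forall x, A x -> ~ N x /\ (back_weight x <= C%:E)%E) ->
  exists (del : R) (B : set X), [/\ 0 < del, measurable B, (mu B <= e%:E)%E &
    forall y n, ~ N y -> ~ B y -> A (iter n f y) -> del <= rho (y, iter n f y)].
Proof.
move=> mA e0 hA.
pose B k := [set y | exists n, A (iter n f y) /\ rho (y, iter n f y) < k.+1%:R^-1].
have mB k : measurable (B k).
  rewrite (_ : B k = \bigcup_n ([set y | A (iter n f y)] `&`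
      [set y | rho (y, iter n f y) < k.+1%:R^-1])); last first.
    by apply/seteqP; split=> y [n]; [exists n|move=> _ ?; exists n].
  apply: bigcupT_measurable => n; apply: measurableI.
    exact: (@measurable_preimage _ _ _ _ (fun y => iter n f y) A (measurable_iter fm n)).
  have mr := measurable_rho (@measurable_id _ X setT) (measurable_iter fm n)
    (fun y => E_iter f y n).
  have := mr measurableT `]-oo, k.+1%:R^-1[%classic (measurable_itv _); rewrite setTI.
  by congr measurable; apply/seteqP; split=> y; rewrite /preimage /mkset /= in_itv.
have [k hk] : exists k, (mu (B k) <= e%:E)%E.
  apply: mu_decreasing_small => //.
    move=> k y [n [An lt]]; exists n; split=> //; apply: lt_le_trans lt _.
    by rewrite lef_pV2 ?posrE ?ltr0n // ler_nat.
  apply: ae_null; first exact: bigcapT_measurable.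
  have := light_visits_finite mA hA.
  apply: filterS => y hfin hB.
  have /choice[h hh] : forall n, exists k : nat, k.+1%:R^-1 <= rho (y, iter n f y).
    move=> n; have r0 := rho_gt0 (E_sym (E_sym (E_iter f y n))).
    by have [k _ /(_ k (leqnn k)) /ltW nr] := near_infty_natSinv_lt (PosNum r0); exists k.
  have [m hm] := finite_set_bounded h hfin.
  have [n [An lt]] := hB m I; have := hh n; rewrite leNgt => /negP; apply.
  apply: lt_le_trans lt _; rewrite lef_pV2 ?posrE ?ltr0n // ler_nat ltnS.
  exact: hm.
exists k.+1%:R^-1, (B k); split=> //.
move=> y n nN nB An; rewrite leNgt; apply/negP => lt; apply: nB; exists n; split=> //.
Qed.

(** Let [A C] be the set of points [x] of light classes with mass at most [C]
    behind them.  By [bad_level] and the Borel-Cantelli lemma there are bounds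
    [del C] such that almost every [y] has weight at least [del C] relative to
    its visits to [A C], for all [C] beyond some [n].  The points [y] whose [n] is
    the least in their class form a set [A0] with finitely many points behind each
    [x], because these points have weight at least [del C] relative to [x] for one
    large [C], and the mass behind [x] is finite.  The points in front of [A0]
    form the required set: behind the points of a backward ray in it there would
    be decreasing nonempty finite subsets of [A0], hence a point behind the whole
    ray. *)
Lemma light_one_ended : exists Y, [/\ measurable Y, forward_closed f Y,
    (forall r, backray f r -> ~ forall n, Y (r n)) &
    \forall x \ae mu, (forall y, E (x, y) -> ~ heavy y) -> exists2 y, E (x, y) & Y y].
Proof.
pose L := ~` N `\` sat heavy.
have mL : measurable L.
  apply: measurableD; first exact: measurableC.
  by apply: measurable_sat; exact: measurable_heavy.
have iL x y : E (x, y) -> L x -> L y.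
  move=> xy [nN ns]; split; first exact: invN nN.
  by move=> /(invariant_sat (E_sym xy)).
have L_light x : L x -> (back_weight x < +oo)%E.
  move=> [nN ns]; rewrite ltey; apply/eqP => h; apply: ns; split=> //.
  by exists x; split; [exact: E_refl|].
pose A (C : nat) := L `&` [set x | ~ N x /\ (back_weight x <= C%:R%:E)%E].
have mA C : measurable (A C).
  by apply: measurableI => //; exact: measurable_back_weight_le.
have /choice[del /choice[B hB]] : forall C : nat, exists (del : R) (B : set X),
   [/\ 0 < del, measurable B, (mu B <= (1 / (2 ^ C.+1)%:R)%:E)%E &
    forall y n, ~ N y -> ~ B y -> A C (iter n f y) -> del <= rho (y, iter n f y)].
  move=> C; apply: (@bad_level (A C) C%:R).
  - exact: mA.
  - by rewrite divr_gt0 // ltr0n expn_gt0.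
  - by move=> x [].
have mB C : measurable (B C) by case: (hB C).
pose T n := \bigcap_(j in [set j | (n <= j)%N]) ~` B j.
have mT n : measurable (T n).
  by apply: bigcap_measurableType => j _; exact: measurableC.
have aeT : \forall x \ae mu, exists n, T n x.
  have nl : mu (lim_sup_set B) = 0%E.
    apply: lim_sup_set_cvg0 => //; apply: (@le_lt_trans _ _ (1%R)%:E); last exact: ltry.
    apply: le_trans (epsilon_trick0 xpredT (@ler01 R)).
    by apply: lee_nneseries => // i _; case: (hB i).
  have ml : measurable (lim_sup_set B).
    by apply: bigcap_measurableType => n _; apply: bigcup_measurable => j _; exact: mB.
  have := null_ae ml nl; apply: filterS => x nx; apply: contrapT => /forallNP h.
  apply: nx => n _; apply: contrapT => nB; apply: (h n) => j nj Bj.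
  by apply: nB; exists j.
(* [T n] consists of the points for which the bounds hold from [n] on, and [S n]
   of those in whose class no smaller number will do. *)
pose S n := L `&` T n `\` \bigcup_(m in [set m | (m < n)%N]) sat (T m).
have mS n : measurable (S n).
  apply: measurableD; first exact: measurableI.
  by apply: bigcup_measurable => m _; exact: measurable_sat.
pose A0 := \bigcup_n S n.
have mA0 : measurable A0 by exact: bigcupT_measurable.
have S_level m n x y : S m x -> S n y -> E (x, y) -> m = n.
  move=> [[Lx Tx] hx] [[Ly Ty] hy] xy; apply/eqP; rewrite eqn_leq.
  rewrite leqNgt; apply/andP; split; last rewrite leqNgt; apply/negP => lt.
    by apply: hx; exists n => //; split; [case: Lx|exists y].
  apply: hy; exists m => //; split; first by case: Ly.
  by exists x; split=> //; exact: E_sym.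
pose Y := [set x | ~ N x /\ exists y, E (x, y) /\ (A0 y /\ back f x y)].
have mY : measurable Y.
  apply: (measurable_ex (D := [set p | A0 p.2] `&` [set p | back f p.1 p.2])).
  by apply: measurableI; [exact: snd_pre|exact: measurable_back].
exists Y; split=> //.
- move=> x [nN [y [xy [Ay bxy]]]]; split; first exact: invN (E_f f x) nN.
  exists y; split; first exact: E_trans (E_sym (E_f f x)) xy.
  by split=> //; exact: back_f.
- move=> r hr Yr.
  have [y0 [ry0 [[m _ Sy0] by0]]] := (Yr 0%N).2.
  have Lr : L (r 0%N) by apply: iL (E_sym ry0) _; case: Sy0 => -[].
  have fA : finite_set (A0 `&` back f (r 0%N)).
    have wf : back_weight (r 0%N) \is a fin_num.
      rewrite ge0_fin_numE ?L_light //; apply: esum_ge0 => y /E_back yx.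
      by rewrite lee_fin ltW // rho_gt0 //; exact: E_sym.
    (* beyond the number of the class, and large enough for [r 0] to be in [A C] *)
    pose C := maxn m (Num.truncn (fine (back_weight (r 0%N)))).+1.
    have hC : (back_weight (r 0%N) <= C%:R%:E)%E.
      rewrite -(fineK wf) lee_fin; apply: (le_trans (ltW (truncnS_gt _))).
      by rewrite ler_nat leq_maxr.
    apply: (@finite_large_weight (r 0%N) _ (del C) C%:R) => //; first by case: (hB C).
    move=> y [[n _ Sy] ryb]; split=> //; case: ryb (ryb) => a ea ryb.
    have yr : E (y, r 0%N) by apply: E_sym; exact: E_back.
    have nm : n = m by apply: S_level Sy Sy0 _; exact: E_trans yr ry0.
    case: Sy => -[Ly Ty] _; case: (hB C) => _ _ _ /(_ y a); rewrite ea; apply.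
    + by case: Ly.
    + by apply: (Ty C); rewrite /mkset nm leq_maxl.
    + by split=> //; split=> //; case: Lr.
  have [z hz] : \bigcap_n (A0 `&` back f (r n)) !=set0.
    apply: (finite_decreasing fA).
    + move=> n y [Ay yb]; split=> //; apply: back_trans yb; exists n.
      by have := backray_iter n 0 hr; rewrite addn0.
    + by move=> n y [Ay yb]; split=> //; apply: back_trans yb; exists 1%N => /=; exact: hr.
    + by move=> n; have [_ [y [_ [Ay yb]]]] := Yr n; exists y.
  by apply: (back_not_all (z := z) hr) => n; case: (hz n I).
- apply: filterS2 ae_notN aeT => x nN [n0 Tn0] hx.
  have Lx : L x by split=> // -[_ [y [xy hy]]]; exact: hx hy.
  have nP : exists n, `[<sat (T n) x>].
    by exists n0; apply/asboolP; split=> //; exists x; split=> //; exact: E_refl.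
  case: (ex_minnP nP) => n /asboolP[_ [y [xy Ty]]] hn.
  exists y => //; split; first exact: invN nN.
  exists y; split; first exact: E_refl.
  split; last by exists 0%N.
  exists n => //; split; first by split=> //; exact: iL Lx.
  move=> [m mn sm]; have : sat (T m) x by apply: invariant_sat sm; exact: E_sym.
  by move/asboolP/hn; rewrite leqNgt mn.
Qed.

(** * Barytropic ends and the classification of the classes *)

Local Notation T := (graph_of f).
Local Notation W := heavy.
Local Notation bary x := (barytropic_ends rho T x).

Lemma backray_geodesic (Y : set X) r : backray f r -> (forall n, Y (r n)) ->
  geodesic_ray T r.
Proof. by move=> hr _; rewrite -inducedT; apply: backray_ray. Qed.

Lemma barytropic_endsE x : ~ N x ->
  (forall z, E (x, z) -> rho_infinite rho x ([set y | E (x, y)] `\` back f z)) ->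
  bary x = ray_ends f T W x.
Proof.
move=> nN hx; have endsE : ends T x = ray_ends f T setT x.
  by have := @ends_ray_ends _ X f facyc setT x (fun _ _ _ => I) I; rewrite inducedT.
apply/seteqP; split=> xi.
  move=> []; rewrite endsE => -[->|[r [hr _ xr ->]]] hb; first by left.
  right; exists r; split=> // n; split; first by apply: (invN (backray_class n hr xr) nN).
  have h := hb _ (half_space_back facyc (r n)) (in_closure_back facyc n hr).
  apply: (rho_infinite_base _ (backray_class n hr xr) h) => y /E_back ry.
  by apply: E_sym; exact: E_trans (backray_class n hr xr) ry.
case=> [->|[r [hr Wr xr ->]]].
  split; first by rewrite endsE; left.
  move=> U hU /(half_space_forward hU)[z [xz sub]].
  exact: esum_subset_oo sub (hx _ xz).
split; first by rewrite endsE; right; exists r.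
move=> U hU /(half_space_backray facyc hU hr)[n sub].
apply: (esum_subset_oo sub).
apply: (rho_infinite_base _ (E_sym (backray_class n hr xr)) (Wr n).2).
by move=> y /E_back; exact: E_sym.
Qed.

Definition has_predecessors (Z : set X) x :=
  forall y, E (x, y) -> Z y -> exists2 z, Z z & f z = y.

Lemma ray_from (Z : set X) x y : has_predecessors Z x -> Z y -> E (x, y) ->
  exists r, [/\ backray f r, forall n, Z (r n) & r 0%N = y].
Proof.
move=> hZ Zy xy.
have [|r [hr Zr r0]] := @backray_exists _ X f (Z `&` [set y | E (x, y)]) y _ (conj Zy xy).
  move=> u [Zu xu]; have [v Zv e] := hZ u xu Zu; exists v => //; split=> //.
  by apply: (E_trans xu); rewrite -e; apply: E_sym; exact: E_f.
by exists r; split=> // n; case: (Zr n).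
Qed.

(** On a class without such points [f] is injective on [Z]. *)
Definition siblings (Z : set X) := [set y | Z y /\
  (~ N y /\ exists z, E (y, z) /\ (Z z /\ f z = f y /\ z <> y))].

Lemma measurable_siblings Z : measurable Z -> measurable (siblings Z).
Proof.
move=> mZ; apply: (measurableI Z _ mZ).
apply: (measurable_ex (D := [set p | Z p.2] `&`
  ([set p | f p.2 = f p.1] `&` ~` [set p | p.2 = p.1]))).
apply: measurableI.
  exact: (@measurable_preimage _ _ _ _ (@snd X X) Z measurable_snd mZ).
apply: measurableI.
  apply: measurable_eq_set; first exact: (measurable_iter_snd 1).
  exact: (measurable_iter_fst 1).
by apply: measurableC; apply: measurable_eq_set; [exact: measurable_snd|exact: measurable_fst].
Qed.

Section Classes.
Variables (T' : rel X) (Y Z : set X) (x : X).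
Hypothesis nNx : ~ N x.
Hypothesis gT : forall r, backray f r -> (forall n, Y (r n)) -> geodesic_ray T' r.
Hypothesis ZY : forall y, E (x, y) -> Z y -> Y y.
Hypothesis hZ : has_predecessors Z x.
Hypothesis rZ : forall r, backray f r -> (forall n, Y (r n)) -> E (x, r 0%N) ->
  forall n, Z (r n).
Hypothesis fZ : forward_closed_at f x Z.

Lemma empty_core_one : (forall y, E (x, y) -> ~ Z y) -> ray_ends f T' Y x #= `I_1.
Proof. by move=> nZ; apply: ray_ends_one => r hr Yr xr; apply: (nZ (r 0%N)) => //; exact: rZ. Qed.

Lemma line_core_two : (exists y, E (x, y) /\ Z y) ->
  (forall y, E (x, y) -> ~ siblings Z y) -> ray_ends f T' Y x #= `I_2.
Proof.
move=> [y [xy Zy]] nS; apply: (@ray_ends_two _ X f facyc T' Y x gT Z) => //.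
  move=> u v Zu Zv xu e; apply: contrapT => uv; apply: (nS u xu); split=> //.
  split; first exact: (invN xu nNx).
  exists v; split; last by split=> //; split=> // vu; apply: uv.
  by apply/E_ofP; exists 1%N, 1%N.
have [r [hr Zr r0]] := ray_from hZ Zy xy.
have xr : E (x, r 0%N) by rewrite r0.
by exists r; split=> // n; apply: ZY => //; exact: backray_class.
Qed.

Lemma branching_core_three y : E (x, y) -> siblings Z y -> `I_3 #<= ray_ends f T' Y x.
Proof.
move=> xy [Zy [_ [z [yz [Zz [e ne]]]]]].
have xz := E_trans xy yz.
have [r [hr Zr r0]] := ray_from hZ Zy xy.
have [s [hs Zs s0]] := ray_from hZ Zz xz.
have xr : E (x, r 0%N) by rewrite r0.
have xs : E (x, s 0%N) by rewrite s0.
apply: (ray_ends_three facyc gT hr hs) => //.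
- by move=> n; apply: ZY => //; exact: backray_class.
- by move=> n; apply: ZY => //; exact: backray_class.
- apply: (siblings_not_tail facyc hr hs); first by rewrite r0 s0.
  by rewrite r0 s0 => /esym.
Qed.

Definition branching := [set b | exists y, [/\ siblings Z y & f y = b]].

Lemma finitely_many_branchings : finite_set (ray_ends f T' Y x) ->
  exists m, forall k, branching (iter k f x) -> (k <= m)%N.
Proof.
move=> hfin; apply: (ray_ends_finite facyc gT _ hfin) => k [y [[Zy [nNy [z [yz [Zz [e ne]]]]]] fy]].
have xk := E_iter f x k.
have xy : E (x, y) by apply: (E_trans xk); rewrite -fy; apply: E_sym; exact: E_f.
have xz := E_trans xy yz.
have [u [Zu xu fu nu]] : exists u, [/\ Z u, E (x, u), f u = iter k f x & u <> iter k.-1 f x].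
  have [yk|nk] := pselect (y = iter k.-1 f x); last by exists y.
  by exists z; split=> //; [rewrite e|rewrite -yk].
have [r [hr Zr r0]] := ray_from hZ Zu xu.
have xr : E (x, r 0%N) by rewrite r0.
exists r; split=> //; rewrite ?r0 // => n; apply: ZY => //; exact: backray_class.
Qed.

End Classes.

Lemma essentially_ended_forward (A Y : set X) n : measurable Y -> Y `<=` A ->
  invariant_set E A -> forward_closed f Y ->
  (forall x, A x -> exists2 y, E (x, y) & Y y) ->
  (forall x, Y x -> ray_ends f (induced T Y) Y x #= `I_n) ->
  essentially_ended T A n.
Proof.
move=> mY YA iA fY hA hY; exists Y; split=> //.
- exact: forward_closed_convex.
- by move=> x Ax; have [y xy Yy] := hA x Ax; exists y => //; exact: joined_invariant.
- move=> x Yx; rewrite ends_ray_ends //; [exact: hY|exact: forward_closed_all].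
Qed.

(** Let [Z] be the backward core of the heavy points.  The part [X1] where [Z] is
    empty is essentially one-ended because of the heavy points, or of the set
    given by [light_one_ended] on the classes without heavy points; the part [X2]
    where [Z] is a line is essentially two-ended because of [Z]. *)
Lemma ae_classify : exists N' X1 X2 : set X,
  [/\ measurable N', mu N' = 0%E & invariant_set E N'] /\
  [/\ measurable X1, invariant_set E X1, X1 `<=` ~` N', essentially_ended T X1 1
    & forall x, X1 x -> bary x #= `I_1] /\
  [/\ measurable X2, invariant_set E X2, X2 `<=` ~` N', essentially_ended T X2 2
    & forall x, X2 x -> bary x #= `I_2] /\
  forall x, ~ N' x -> ~ X1 x -> ~ X2 x -> `I_3 #<= bary x.
Proof.
have [Z [mZ ZW fZ rZ aeZ]] := backward_core measurable_heavy heavy_forward.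
have [Y0 [mY0 fY0 rY0 aeY0]] := light_one_ended.
have aeF := forward_half_infinite.
have [N' [mN' N'0 iN' good]] := ae_invariant hmcp
  (filterI ae_notN (filterI aeZ (filterI aeY0 aeF))).
pose SW := sat W; pose SZ := sat Z; pose SB := sat (siblings Z).
have mSW : measurable SW := measurable_sat measurable_heavy.
have mSZ : measurable SZ by exact: measurable_sat.
have mSB : measurable SB by apply: measurable_sat; exact: measurable_siblings.
have iC (A : set X) : invariant_set E A -> invariant_set E (~` A).
  exact: invariant_setC.
have iI (A B : set X) : invariant_set E A -> invariant_set E B -> invariant_set E (A `&` B).
  by move=> hA hB x y xy [Ax Bx]; split; [exact: hA Ax|exact: hB Bx].
have rayW x : forall r, backray f r -> (forall n, W (r n)) -> E (x, r 0%N) ->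
    forall n, Z (r n).
  by move=> r hr Wr _; exact: rZ.
pose X1 := ~` N' `&` ~` SZ; pose X2 := ~` N' `&` (SZ `&` ~` SB).
have mX1 : measurable X1 by apply: measurableI; exact: measurableC.
have mX2 : measurable X2.
  by apply: measurableI; [exact: measurableC|apply: measurableI => //; exact: measurableC].
have iX1 : invariant_set E X1 := iI _ _ (iC _ iN') (iC _ (@invariant_sat _)).
have iX2 : invariant_set E X2 :=
  iI _ _ (iC _ iN') (iI _ _ (@invariant_sat _) (iC _ (@invariant_sat _))).
have noZ x : X1 x -> forall y, E (x, y) -> ~ Z y.
  move=> [nN' nSZ] y xy Zy; apply: nSZ; have [nN _] := good x nN'.
  by split=> //; exists y.
have noB x : X2 x -> forall y, E (x, y) -> ~ siblings Z y.
  move=> [nN' [_ nSB]] y xy By; apply: nSB; have [nN _] := good x nN'.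
  by split=> //; exists y.
have baryE x : ~ N' x -> bary x = ray_ends f T W x.
  by move=> /good[nN [_ [_ hF]]]; exact: barytropic_endsE.
exists N', X1, X2; split=> //; split; [|split].
- split=> //; first by move=> x [].
    pose Y := X1 `&` ((Y0 `&` ~` SW) `|` (W `&` SW)).
    apply: (@essentially_ended_forward X1 Y) => //.
    + apply: measurableI => //; apply: measurableU.
        by apply: measurableI => //; exact: measurableC.
      exact: (measurableI _ _ measurable_heavy mSW).
    + by move=> x [].
    + move=> x [X1x h]; split; first exact: iX1 (E_f f x) X1x.
      case: h => -[h1 h2]; [left|right]; split.
      * exact: fY0.
      * by apply: (iC _ (invariant_sat (A := W)) _ _ (E_f f x)).
      * exact: heavy_forward.
      * exact: (invariant_sat (E_f f x)).
    + move=> x X1x; have [nN' nSZ] := X1x; have [nN [_ [hY _]]] := good x nN'.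
      have [Sx|nSx] := pselect (SW x).
        have [_ [y [xy Wy]]] := Sx; exists y => //; split; first exact: iX1 xy X1x.
        by right; split=> //; exact: (invariant_sat xy).
      have [y xy Yy] : exists2 y, E (x, y) & Y0 y.
        by apply: hY => y xy Wy; apply: nSx; split=> //; exists y.
      exists y => //; split; first exact: iX1 xy X1x.
      by left; split=> //; apply: (iC _ (invariant_sat (A := W)) _ _ xy).
    + move=> x [X1x _]; apply: (@empty_core_one _ Y Z) => //; last exact: noZ.
      move=> r hr Yr xr; case: (Yr 0%N) => X1r h.
      have S_ray A n : sat A (r n) -> sat A (r 0%N).
        apply: invariant_sat; apply: E_sym; apply: (backray_class n hr); exact: E_refl.
      case: h => -[h1 h2].
        case: (rY0 r hr) => n; case: (Yr n) => _ [[]//|[_ /S_ray]].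
        by case/h2.
      suff Wr : forall n, W (r n) by apply: rZ.
      by move=> n; case: (Yr n) => _ [[_ nS]|[]//]; case: nS; apply: (invariant_sat _ h2);
        apply: (backray_class n hr); exact: E_refl.
  move=> x X1x; have [nN' _] := X1x; rewrite baryE //.
  by apply: (@empty_core_one _ W Z) => //; [exact: rayW|exact: noZ].
- split=> //; first by move=> x [].
    apply: (@essentially_ended_forward X2 (X2 `&` Z)) => //.
    + exact: measurableI.
    + by move=> x [X2x Zx]; split; [exact: (iX2 _ _ (E_f f x) X2x)|exact: (fZ _ Zx)].
    + move=> x X2x; have [nN' [[_ [y [xy Zy]]] _]] := X2x.
      by exists y => //; split=> //; exact: iX2 xy X2x.
    + move=> x [X2x Zx]; have [nN' _] := X2x; have [nN [hp _]] := good x nN'.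
      apply: (@line_core_two _ (X2 `&` Z) Z) => //.
      * by move=> r hr Yr; exact: backray_ray.
      * by move=> y xy Zy; split=> //; exact: iX2 xy X2x.
      * by move=> r hr Yr _ n; case: (Yr n).
      * exact: forward_closed_all.
      * by exists x; split=> //; exact: E_refl.
      * exact: noB.
  move=> x X2x; have [nN' [[_ hex] _]] := X2x; have [nN [hp _]] := good x nN'.
  rewrite baryE //; apply: (@line_core_two _ W Z) => //.
  + exact: backray_geodesic.
  + by move=> y _; exact: ZW.
  + exact: rayW.
  + exact: forward_closed_all.
  + exact: noB.
- move=> x nN' nX1 nX2; have [nN [hp _]] := good x nN'.
  have Sx : SZ x by apply: contrapT => h; apply: nX1.
  have [_ [y [xy By]]] : SB x by apply: contrapT => h; apply: nX2.
  rewrite baryE //; apply: (@branching_core_three _ W Z _ _ _ _ y) => //.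
  + exact: backray_geodesic.
  + by move=> z _; exact: ZW.
Qed.

Lemma meet_siblings (Z : set X) x y : forward_closed f Z -> ~ N x -> Z x -> Z y ->
  E (x, y) -> (exists k, iter k f x = y) \/ (exists k, iter k f y = x) \/
  exists u k l, [/\ siblings Z u, f u = iter k.+1 f x & f u = iter l.+1 f y].
Proof.
move=> fZ nN Zx Zy xy; have [m [n [e hmin]]] := meet_minimal facyc xy.
case: m n e hmin => [|m] [|n] e hmin.
- by left; exists 0%N.
- by right; left; exists n.+1.
- by left; exists m.+1.
right; right; exists (iter m f x), m, n; split=> //.
split; first exact: forward_closed_iter.
split; first exact: (invN (E_iter f x m) nN).
exists (iter n f y); split.
  by apply/E_ofP; exists 1%N, 1%N.
split; first exact: forward_closed_iter.
split; first by move: e => /= ->.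
by move=> e'; have [] := hmin m n (leqnSn m) (esym e'); lia.
Qed.

(** The last visits to [B] form a transversal. *)
Lemma last_visit_avoid (B : set X) : measurable B ->
  (forall x y, B x -> B y -> E (x, y) ->
     (exists k, iter k f x = y) \/ (exists k, iter k f y = x)) ->
  (\forall x \ae mu, finite_set [set n | B (iter n f x)]) ->
  \forall x \ae mu, forall y, E (x, y) -> ~ B y.
Proof.
move=> mB cB fB; pose M := B `\` \bigcup_k (iter k.+1 f @^-1` B).
have mM : measurable M.
  apply: measurableD => //; apply: bigcupT_measurable => k.
  exact: (measurable_preimage (measurable_iter fm k.+1) mB).
have avoid : \forall x \ae mu, forall y, E (x, y) -> ~ M y.
  apply: (transversal_avoid mM).
  apply: aeW => x y z [By ny] [Bz nz] xy xz.
  have [[[|k] e]|[[|k] e]] := cB y z By Bz (E_trans (E_sym xy) xz).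
  - exact: e.
  - by case: ny; exists k => //; rewrite /preimage /mkset e.
  - by rewrite -e.
  - by case: nz; exists k => //; rewrite /preimage /mkset e.
apply: filterS2 avoid (ae_class hmcp fB) => x avoid hf y xy By.
have [m hm] := finite_set_bounded id (hf y xy).
have {hf} last : exists2 k, B (iter k f y) & forall j, (k < j)%N -> ~ B (iter j f y).
  have bnd : forall j, B (iter j f y) -> (j <= m)%N by exact: hm.
  have exP : exists j, `[<B (iter j f y)>] by exists 0%N; apply/asboolP.
  have bP j : `[<B (iter j f y)>] -> (j <= m)%N by move/asboolP; exact: bnd.
  have [k /asboolP Bk hk] := ex_maxnP exP bP; exists k => // j kj Bj.
  by have := hk j (asboolT Bj); rewrite leqNgt kj.
have [k Bk hk] := last; apply: (avoid (iter k f y)).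
  exact: E_trans xy (E_iter f y k).
split=> // -[j _]; rewrite /preimage /mkset -iterD; apply: hk.
by rewrite addSn ltnS leq_addl.
Qed.

(** The set [M] of exits of [Y0] and the set [M2] of last branching points of its
    backward core [Z] are partial transversals.  On a class where [Z] is a line,
    all its points are heavy by [last_visit_avoid] applied to the points with a
    bounded mass behind them. *)
Lemma essentially_ended_ae (A : set X) n : measurable A -> invariant_set E A ->
  essentially_ended T A n -> \forall x \ae mu, A x ->
  (n = 1%N /\ bary x #= `I_1) \/ (n = 2%N /\ bary x #= `I_2).
Proof.
move=> mA iA [Y0 [mY0 Y0A cY0 hY0 nY0]].
pose M := Y0 `\` (f @^-1` Y0).
have mM : measurable M.
  by apply: measurableD => //; exact: (measurable_preimage fm mY0).
have aeM : \forall x \ae mu, forall y, E (x, y) -> ~ M y.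
  apply: (transversal_avoid mM).
  apply: aeW => x y z [Yy ny] [Yz nz] xy xz.
  exact: (convex_exit_unique facyc iA Y0A cY0 (E_trans (E_sym xy) xz)).
pose Y := Y0 `\` N `\` sat M.
have mY : measurable Y.
  by apply: measurableD; [exact: measurableD|exact: measurable_sat].
have fY : forward_closed f Y.
  move=> x [[Yx nN] nM]; split; last first.
    by move=> h; apply: nM; apply: (invariant_sat _ h); apply: E_sym; exact: E_f.
  split; last exact: (invN (E_f f x) nN).
  apply: contrapT => nYf; apply: nM; split=> //.
  by exists x; split=> //; exact: E_refl.
have aeL := light_outside mY fY.
have [Z [mZ ZY fZ rZ aeZ]] := backward_core mY fY.
pose S := siblings Z; have mS : measurable S by exact: measurable_siblings.
pose Br := [set b | ~ N b /\ exists y, E (b, y) /\ (S y /\ f y = b)].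
have mBr : measurable Br.
  apply: (measurable_ex (D := [set p | S p.2] `&` [set p | f p.2 = p.1])).
  apply: measurableI.
    exact: (@measurable_preimage _ _ _ _ (@snd X X) S measurable_snd mS).
  apply: measurable_eq_set; first exact: (measurable_iter_snd 1).
  exact: measurable_fst.
have BrI u b : ~ N b -> S u -> f u = b -> Br b.
  by move=> nN Su e; split=> //; exists u; split=> //; rewrite -e; apply: E_sym; exact: E_f.
pose M2 := Br `\` \bigcup_k (iter k.+1 f @^-1` Br).
have mM2 : measurable M2.
  apply: measurableD => //; apply: bigcupT_measurable => k.
  exact: (measurable_preimage (measurable_iter fm k.+1) mBr).
have aeM2 : \forall x \ae mu, forall y, E (x, y) -> ~ M2 y.
  apply: (transversal_avoid mM2).
  apply: aeW => x y z [By ny] [Bz nz] xy xz.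
  have yz := E_trans (E_sym xy) xz.
  have nNy := By.1.
  have BrZ b : Br b -> Z b by move=> [_ [u [_ [[Zu _] <-]]]]; exact: fZ.
  have [[[|k] e]|[[[|k] e]|[u [k [l [Su e1 e2]]]]]] :=
    meet_siblings fZ nNy (BrZ _ By) (BrZ _ Bz) yz.
  - exact: e.
  - by case: ny; exists k => //; rewrite /preimage /mkset e.
  - by rewrite -e.
  - by case: nz; exists k => //; rewrite /preimage /mkset e.
  - case: ny; exists k => //; apply: (BrI u) => //.
    exact: (invN (E_iter f y k.+1) nNy).
(* On the classes where [Z] is a line, the points with mass at most [C] behind
   them; the classes where [Z] branches are excluded to make points comparable. *)
pose AC (C : nat) := Z `&` [set x | ~ N x /\ (back_weight x <= C%:R%:E)%E]
    `\` sat S.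
have mAC C : measurable (AC C).
  apply: measurableD; last exact: measurable_sat.
  apply: measurableI => //.
  exact: measurable_back_weight_le.
have aeAC : \forall x \ae mu, forall C : nat, forall y, E (x, y) -> ~ AC C y.
  apply/ae_foralln => C; apply: last_visit_avoid => //.
    move=> x y [[Zx [nN _]] nS] [[Zy _] _] xy.
    have [?|[?|[u [k [l [Su e1 _]]]]]] := meet_siblings fZ nN Zx Zy xy.
    - by left.
    - by right.
    case: nS; split=> //; exists u; split=> //.
    apply: (E_trans (E_iter f x k.+1)); rewrite -e1; apply: E_sym; exact: E_f.
  apply: (light_visits_finite (C := C%:R)) => //.
  by move=> x [[_ ?] _].
have aeF := forward_half_infinite.
apply: filterS2 ae_notN (filterI aeM (filterI aeL (filterI aeZ (filterI aeM2
  (filterI aeAC aeF))))) => x nN [hM [hL [hZ [hM2 [hAC hF]]]]] Ax.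
have [y0 Y0y0 jxy] := hY0 x Ax.
have xy0 : E (x, y0) := joined_sub jxy.
have YE z : E (x, z) -> Y0 z -> Y z.
  move=> xz Yz; split; first by split=> //; exact: (invN xz nN).
  by move=> [_ [w [zw Mw]]]; apply: (hM w) => //; exact: E_trans xz zw.
have YY0 z : Y z -> Y0 z by move=> [[]].
have fY0 b : E (x, b) -> forward_closed_at f b Y0.
  by move=> xb z bz Yz; apply/YY0/fY/YE => //; exact: E_trans xb bz.
have cls b : E (x, b) -> Y0 b -> ray_ends f (induced T Y0) Y0 b #= `I_n.
  move=> xb Yb; rewrite -(ends_ray_ends facyc) //; [exact: nY0|exact: fY0].
have g0 r : backray f r -> (forall n, Y0 (r n)) -> geodesic_ray (induced T Y0) r.
  by move=> hr Yr; exact: backray_ray.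
have rZ0 b r : E (x, b) -> backray f r -> (forall n, Y0 (r n)) -> E (b, r 0%N) ->
    forall n, Z (r n).
  move=> xb hr Yr br; apply: rZ => // k; apply: YE => //.
  exact: (backray_class k hr (E_trans xb br)).
have hZb b : E (x, b) -> has_predecessors Z b.
  by move=> xb y bY; apply: hZ; exact: E_trans xb bY.
have rW r : backray f r -> (forall n, W (r n)) -> E (x, r 0%N) -> forall n, Z (r n).
  move=> hr Wr xr; apply: rZ => // k; apply: contrapT => nY.
  have := hL _ (backray_class k hr xr) (ex_intro _ y0 (conj xy0 (YE _ xy0 Y0y0))) nY.
  by rewrite (Wr k).2 ltxx.
have baryE : bary x = ray_ends f T W x by exact: barytropic_endsE.
have noS : forall u, E (x, u) -> ~ S u.
  move=> u xu Su; pose b := f u.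
  have xb : E (x, b) by apply: (E_trans xu); exact: E_f.
  have Zb : Z b by apply: fZ; case: Su.
  have nNb := invN xb nN.
  have ZYb z : E (b, z) -> Z z -> Y0 z by move=> _ /ZY/YY0.
  have finb : finite_set (ray_ends f (induced T Y0) Y0 b).
    by apply/finite_setP; exists n; exact: (cls b xb (YY0 _ (ZY _ Zb))).
  have [m hm] := finitely_many_branchings g0 ZYb (hZb b xb) finb.
  have exP : exists k, `[<branching Z (iter k f b)>].
    by exists 0%N; apply/asboolP; exists u.
  have bP k : `[<branching Z (iter k f b)>] -> (k <= m)%N by move/asboolP; exact: hm.
  have [k /asboolP [v [Sv fv]] hk] := ex_maxnP exP bP.
  apply: (hM2 (iter k f b)); first exact: E_trans xb (E_iter f b k).
  split; first by apply: (BrI v) => //; exact: (invN (E_iter f b k) nNb).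
  move=> [j _ [_ [w [_ [Sw fw]]]]].
  have : (j.+1 + k <= k)%N by apply: hk; apply/asboolP; exists w; rewrite iterD.
  by rewrite leqNgt addSn ltnS leq_addl.
have [[z [xz Zz]]|nZ] := pselect (exists z, E (x, z) /\ Z z); [right|left].
  have n2 : ray_ends f (induced T Y0) Y0 y0 #= `I_2.
    apply: (@line_core_two (induced T Y0) Y0 Z y0) => //.
    + exact: (invN xy0 nN).
    + by move=> u _ /ZY/YY0.
    + exact: hZb.
    + by move=> r; exact: rZ0.
    + exact: forward_closed_all.
    + by exists z; split=> //; exact: E_trans (E_sym xy0) xz.
    + by move=> u y0u; apply: noS; exact: E_trans xy0 y0u.
  split; first exact: (card_II_inj (cls y0 xy0 Y0y0) n2).
  rewrite baryE; apply: (@line_core_two T W Z x) => //.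
  + exact: backray_geodesic.
  + move=> u xu Zu; have nNu := invN xu nN; split=> //.
    apply: contrapT => nz.
    have wf : (back_weight u < +oo)%E by rewrite ltey; apply/eqP.
    have w0 : (0 <= back_weight u)%E.
      apply: esum_ge0 => v /E_back uv; rewrite lee_fin ltW // rho_gt0 //.
      exact: E_sym.
    have wfin : back_weight u \is a fin_num by rewrite ge0_fin_numE.
    apply: (hAC (Num.truncn (fine (back_weight u))).+1 u xu); split.
      split=> //; split=> //; rewrite -(fineK wfin) lee_fin; apply: ltW.
      exact: truncnS_gt.
    by move=> [_ [v [uv Sv]]]; apply: (noS v) => //; exact: E_trans xu uv.
  + exact: forward_closed_all.
  + by exists z.
have n1 : ray_ends f (induced T Y0) Y0 y0 #= `I_1.
  apply: (@empty_core_one (induced T Y0) Y0 Z y0) => //.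
    by move=> r; exact: rZ0.
  by move=> u y0u Zu; apply: nZ; exists u; split=> //; exact: E_trans xy0 y0u.
split; first exact: (card_II_inj (cls y0 xy0 Y0y0) n1).
rewrite baryE; apply: (@empty_core_one T W Z x) => //.
by move=> u xu Zu; apply: nZ; exists u.
Qed.

End AlmostEverywhere.

(** * The three equivalences *)

Theorem theorem1p3 (R : realType) (d : measure_display) (X : measurableType d)
    (hX : standard_borel R X) (mu : probability X R)
    (f : X -> X) (hf : measurable_fun setT f)
    (hacyclic : acyclic f) (hcount : countable_to_one f)
    (hmcp : mcp mu (E_of f)) (hns : nowhere_smooth mu (E_of f))
    (rho : X * X -> R) (hrho : radon_nikodym_cocycle mu (E_of f) rho) :
  (monobarytropic mu f rho <-> ae_essentially_ended mu f 1) /\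
  (dibarytropic mu f rho <-> ae_essentially_ended mu f 2) /\
  (polybarytropic mu f rho <-> nowhere_essentially_finitely_ended mu f).
Proof.
have [K [V [Kc Vm Vsep Vgen]]] := standard_borel_classes mu hX.
have [N [g [mN N0 iN gm gE]]] := measurable_enumeration hf hmcp Kc Vm Vsep Vgen.
have [N' [X1 [X2 [[mN' N'0 iN'] [[mX1 iX1 X1N e1 c1] [[mX2 iX2 X2N e2 c2] c3]]]]]] :=
  ae_classify hf hacyclic hmcp hns hrho Vm Vsep mN N0 iN gm gE.
have converse := essentially_ended_ae hf hacyclic hmcp hns hrho Vm Vsep mN N0 iN gm gE.
have discard A n : measurable A -> invariant_set (E_of f) A ->
    essentially_ended (graph_of f) A n -> (\forall x \ae mu, A x) ->
    ae_essentially_ended mu f n.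
  move=> mA iA eA aeA; exists (~` A); split.
  - exact: measurableC.
  - apply: ae_null; first exact: measurableC.
    by apply: filterS aeA => x Ax; apply.
  - exact: invariant_setC.
  - by rewrite setCK.
have ended n : ae_essentially_ended mu f n -> \forall x \ae mu,
    (n = 1%N /\ barytropic_ends rho (graph_of f) x #= `I_1) \/
    (n = 2%N /\ barytropic_ends rho (graph_of f) x #= `I_2).
  move=> [A [mA A0 iA eA]].
  have h := converse _ n (measurableC mA) (invariant_setC iA) eA.
  by apply: filterS2 (null_ae mA A0) h => x nAx; apply.
have noteq m n (S : set (set (nat -> X))) : m <> n -> S #= `I_m -> ~ (S #= `I_n).
  by move=> mn hm hn; apply: mn; exact: card_II_inj hm hn.
split; [|split]; split.
- move=> mono; apply: (discard X1) => //.
  apply: filterS2 (null_ae mN' N'0) mono => x nN' h1; apply: contrapT => nX1.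
  have [X2x|nX2] := pselect (X2 x); first exact: (noteq 1 2 _ _ h1 (c2 x X2x)).
  by apply: (card_lt_neq _ (c3 x nN' nX1 nX2) h1).
- by move=> /ended; apply: filterS => x [[_ //]|[]].
- move=> di; apply: (discard X2) => //.
  apply: filterS2 (null_ae mN' N'0) di => x nN' h2; apply: contrapT => nX2.
  have [X1x|nX1] := pselect (X1 x); first exact: (noteq 1 2 _ _ (c1 x X1x) h2).
  by apply: (card_lt_neq _ (c3 x nN' nX1 nX2) h2).
- by move=> /ended; apply: filterS => x [[]|[_ //]].
- move=> poly [A [n [mA iA A0 eA]]].
  have A00 : mu A = 0%E.
    apply: ae_null => //.
    apply: filterS2 poly (converse _ _ mA iA eA) => x h3 h Ax.
    by have [[_]|[_]] := h Ax; apply: (card_lt_neq _ h3).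
  by move: A0; rewrite A00 ltxx.
- move=> nowhere.
  have null A n : measurable A -> invariant_set (E_of f) A ->
      essentially_ended (graph_of f) A n -> mu A = 0%E.
    move=> mA iA eA; apply: contrapT => /eqP A0; apply: nowhere; exists A, n; split=> //.
    by rewrite lt0e A0 measure_ge0.
  have n1 := null_ae mX1 (null _ _ mX1 iX1 e1).
  have n2 := null_ae mX2 (null _ _ mX2 iX2 e2).
  apply: filterS2 (null_ae mN' N'0) (filterI n1 n2) => x nN' [nX1 nX2].
  exact: c3.
Qed.
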